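(* Let $G$ be an abelian topological group (no separation axioms assumed). The following statements are equivalent: (i) $G$ is maximally almost periodic; (ii) every countable subgroup of $G$ is $\mathfrak{g}$-closed in $G$; (iii) every cyclic subgroup of $G$ is $\mathfrak{g}$-closed in $G$.
   Context: $\mathbb{T}=\mathbb{R}/\mathbb{Z}$. For an abelian topological group $G$, $\hat G$ denotes its Pontryagin dual (the group of continuous homomorphisms $G\to\mathbb{T}$). For a sequence $\underline u=(u_n)$ in $\hat G$ put $s_{\underline u}(G)=\{x\in G\mid u_n(x)\longrightarrow 0 \text{ in } \mathbb{T}\}$. For a subgroup $H\leq G$ put $$\mathfrak{g}_G(H)=\bigcap\{s_{\underline u}(G)\mid \underline u\in \hat G^{\mathbb{N}},\ H\leq s_{\underline u}(G)\}.$$ $H$ is called $\mathfrak{g}$-closed in $G$ if $\mathfrak{g}_G(H)=H$. For a topological group $G$, $\rho_G\colon G\to bG$ denotes the Bohr compactification, i.e. the reflection of $G$ into the category of compact Hausdorff groups (every continuous homomorphism from $G$ into a compact Hausdorff group factors uniquely through $\rho_G$ by a continuous homomorphism). $G$ is maximally almost periodic if $\rho_G$ is injective. *)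

(* Defs.v *)
From HB Require Import structures.
From mathcomp Require Import all_boot all_order all_algebra.
From mathcomp Require Import all_classical all_reals all_analysis.

Set Implicit Arguments.
Unset Strict Implicit.
Unset Printing Implicit Defensive.

Import Order.TTheory GRing.Theory Num.Theory.
Import numFieldNormedType.Exports.

Local Open Scope classical_set_scope.
Local Open Scope ring_scope.

Local Notation to_multiplicative := Algebra.to_multiplicative.

HB.mixin Record isTopologicalGroup G & Topological G & Group G := {
  mulg_continuous : continuous (fun x : G * G => (x.1 * x.2)%g) ;
  invg_continuous : continuous (fun x : G => (x^-1)%g)
}.

#[short(type="topologicalGroupType")]
HB.structure Definition TopologicalGroup :=
  {G of Topological G & Group G & isTopologicalGroup G}.

Section ToMultiplicative.
Variable V : topologicalZmodType.

HB.instance Definition _ := Topological.copy (to_multiplicative V) V.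
HB.instance Definition _ := isTopologicalGroup.Build (to_multiplicative V)
  (@add_continuous V) (@opp_continuous V).
End ToMultiplicative.

Definition continuous_hom (G K : topologicalGroupType) (f : G -> K) : Prop :=
  {morph f : x y / (x * y)%g} /\ continuous f.

Definition compact_hausdorff (K : topologicalGroupType) : Prop :=
  compact [set: K] /\ hausdorff_space K.

Definition is_bohr_compactification (G bG : topologicalGroupType)
    (rho : G -> bG) : Prop :=
  [/\ compact_hausdorff bG, continuous_hom rho &
      forall (K : topologicalGroupType) (f : G -> K),
        compact_hausdorff K -> continuous_hom f ->
        exists! g : bG -> K, continuous_hom g /\ f = g \o rho].

(* The reflection is determined up to a unique isomorphism compatible with
   rho, so injectivity of rho does not depend on the chosen pair (bG, rho). *)
Definition maximally_almost_periodic (G : topologicalGroupType) : Prop :=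
  exists (bG : topologicalGroupType) (rho : G -> bG),
    is_bohr_compactification rho /\ injective rho.

Section Circle.
Local Open Scope quotient_scope.
Variable R : realType.

Definition Zint : zmodClosed R := GRing.ZmodClosed.clone R (@Num.int_num_subdef R) _.

Lemma in_Zint x : (x \in Zint) = (x \is a Num.int).
Proof. by []. Qed.

(* R/Z with the quotient group structure and the quotient topology. *)
Definition circle : Type := quotient_topology (Quotient.quot Zint).

HB.instance Definition _ := Topological.on circle.
(* Not [Zmodule.copy]: the choice structures of the two quotients differ. *)
HB.instance Definition _ := GRing.isZmodule.Build circle
  (@Quotient.addqA R Zint) (@Quotient.addqC R Zint)
  (@Quotient.add0q R Zint) (@Quotient.addNq R Zint).

Definition to_circle (x : R) : circle := \pi_(Quotient.quot Zint) x.

Lemma to_circleB : {morph to_circle : x y / x - y}.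
Proof. by move=> x y; rewrite /to_circle raddfB. Qed.

Lemma to_circle_surj (a : circle) : exists x, to_circle x = a.
Proof. by exists (repr (a : Quotient.quot Zint)); rewrite /to_circle reprK. Qed.

Lemma to_circle_eq x y : to_circle x = to_circle y <-> x - y \is a Num.int.
Proof.
rewrite -in_Zint Quotient.idealrBE.
split=> [xy|/eqP //]; exact/eqP.
Qed.

Lemma to_circle_continuous : continuous to_circle.
Proof. exact: pi_continuous. Qed.

Lemma to_circle_open (U : set R) : open U -> open (to_circle @` U).
Proof.
move=> oU; rewrite /open /= /quotient_open.
have -> : \pi_(quotient_topology (Quotient.quot Zint)) @^-1` (to_circle @` U) =
    \bigcup_(n in [set: int]) ((fun x => x + n%:~R) @^-1` U).
  apply/seteqP; split=> x /=.
    move=> [y Uy] /to_circle_eq /intrP[n yx]; exists n => //=.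
    by rewrite -yx addrC subrK.
  move=> [n _ /= Uxn]; exists (x + n%:~R) => //; apply/to_circle_eq.
  by rewrite addrAC subrr add0r intr_int.
apply: bigcup_open => n _; apply: open_comp => // x _.
by apply: cvgD; [exact: cvg_id|exact: cvg_cst].
Qed.

Lemma circle_sub_continuous :
  continuous (fun a : circle * circle => a.1 - a.2).
Proof.
move=> [a b]; have [x <-] := to_circle_surj a; have [y <-] := to_circle_surj b.
move=> W /=; rewrite -to_circleB.
move=> /(to_circle_continuous (x := x - y)) /=.
move=> /(@sub_continuous R^o (x, y)) [[U V] [/= Ux Vy] UVW].
have nbhs_im (z : R) (A : set R) : nbhs z A ->
    nbhs (to_circle z) (to_circle @` A).
  rewrite nbhsE => -[B [oB Bz] BA]; rewrite nbhsE; exists (to_circle @` B).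
    by split; [exact: to_circle_open | exists z].
  exact: image_subset.
exists (to_circle @` U, to_circle @` V); first by split; exact: nbhs_im.
move=> [c d] /= [[u Uu <-] [v Vv <-]].
rewrite -to_circleB; exact: (UVW (u, v)).
Qed.

HB.instance Definition _ :=
  PreTopologicalNmodule_isTopologicalZmodule.Build circle circle_sub_continuous.

End Circle.

Section GClosed.
Variables (R : realType) (G : topologicalZmodType).

(* Only the underlying set: the group structure and topology are not needed. *)
Definition pontryagin_dual : set (G -> circle R) :=
  [set chi | {morph chi : x y / x + y} /\ continuous chi].

Definition s_set (u : nat -> G -> circle R) : set G :=
  [set x | u n x @[n --> \oo] --> (0 : circle R)].

Definition g_closure (H : set G) : set G :=
  \bigcap_(u in [set u | (forall n, pontryagin_dual (u n)) /\ H `<=` s_set u]) s_set u.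

Definition g_closed (H : set G) : Prop := g_closure H = H.

End GClosed.

Definition is_subgroup (G : zmodType) (H : set G) : Prop := zmod_closed [in H].

Definition cyclic_subgroup (G : zmodType) (x : G) : set G :=
  range (fun n : int => x *~ n).

(* Main.v *)
(* Everything rests on the continuous characters of G: G is maximally almost periodic
   iff they separate points.

   If G maps continuously to a compact group K by phi, finitely many continuous
   characters of G control phi near 1 (the abelian Peter-Weyl theorem). For a bump
   function F at 1 in K, f = F o phi is almost periodic, so finitely generated pieces of
   G are approximated, as far as f can see, by finite groups (Z/N)^r. A character of
   (Z/N)^r with a large Fourier coefficient on the autocorrelation of f varies slowly
   along the almost periods of f, and there are boundedly many such characters. They
   are numerous enough, by Parseval, to detect every a with phi a outside U U^-1 U U^-1,
   where U contains the support of F.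
   An ultrafilter limit of these characters is a tuple of continuous characters of G.

   For H countable and x outside H, choose an angle theta <> 0 killed by every k such
   that k x is in H. By Kronecker's theorem some u_n in the dual is close to 0 on
   the first n elements of H and close to theta at x, so u_n tends to 0 on H but not at x.

   Conversely, if the trivial subgroup is g-closed, characters separate points; bG is the
   closure of G in a power of the circle, and a homomorphism phi : G -> K extends to
   bG along the closure of its graph, which is the graph of a function because finitely many
   characters control phi near 1. *)
From HB Require Import structures.
Require Import Defs.
From mathcomp Require Import all_boot all_order all_algebra.
From mathcomp Require Import all_classical all_reals all_analysis.
From mathcomp Require Import lra.

Set Implicit Arguments.
Unset Strict Implicit.
Unset Printing Implicit Defensive.

Import Order.TTheory GRing.Theory Num.Theory.
Import numFieldNormedType.Exports.

Local Open Scope classical_set_scope.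
Local Open Scope ring_scope.

(** * The cosine on the circle *)

Lemma continuous_pair_comp (T X Y Z : topologicalType) (op : X * Y -> Z)
    (f : T -> X) (g : T -> Y) :
  continuous op -> continuous f -> continuous g ->
  continuous (fun t => op (f t, g t)).
Proof.
move=> opc fc gc t W /(opc (f t, g t))[[U V] [/= fU gV] UVW].
have {}fU : nbhs t (f @^-1` U) by exact: fc.
have {}gV : nbhs t (g @^-1` V) by exact: gc.
rewrite /nbhs /=; apply: filterS (filterI fU gV) => s [Us Vs].
exact: (UVW (f s, g s)).
Qed.

Lemma cluster_continuous_eq (X Y : topologicalType) (g : X -> Y) (p q : X) :
  hausdorff_space Y -> continuous g -> cluster (nbhs p) q -> g p = g q.
Proof.
by move=> hY gc pq; apply: hY => A B /gc gA /gc gB; have [x []] := pq _ _ gA gB; exists (g x).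
Qed.

Section CircleCos.
Variable R : realType.
Implicit Types (x y : R) (a b : circle R).

Definition circle_lift a : R := xget 0 [set x | to_circle x = a].

Lemma circle_liftK a : to_circle (circle_lift a) = a.
Proof.
by have [x xa] := to_circle_surj a; rewrite /circle_lift; case: xgetP => // /(_ x).
Qed.

(** [ccos a] and [csin a] are the real and imaginary parts of exp(2 pi i a), whatever the
    representative; [1 - ccos a] serves throughout as the measure of how far [a] is from 0. *)
Definition ccos a : R := cos (pi *+ 2 * circle_lift a).
Definition csin a : R := sin (pi *+ 2 * circle_lift a).

Lemma periodic_int (f : R -> R) x y :
  periodic f (pi *+ 2) -> x - y \is a Num.int -> f (pi *+ 2 * x) = f (pi *+ 2 * y).
Proof.
move=> pf /intrP[[n|n] xy].
  have -> : x = y + n%:R by rewrite -[n%:R]/(n%:~R) -xy addrC subrK.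
  by rewrite mulrDr mulr_natr (periodicn pf).
have -> : y = x + n.+1%:R by rewrite -(subKr x y) xy NegzE mulrNz opprK.
by rewrite mulrDr mulr_natr (periodicn pf).
Qed.

Lemma to_circle0 : to_circle 0 = 0 :> circle R.
Proof. by have := to_circleB (0 : R) 0; rewrite !subrr. Qed.

Lemma to_circleD : {morph @to_circle R : x y / x + y}.
Proof.
move=> x y; rewrite -[y in LHS]opprK to_circleB.
by rewrite -[- y]add0r to_circleB to_circle0 add0r opprK.
Qed.

Lemma ccosE x : ccos (to_circle x) = cos (pi *+ 2 * x).
Proof.
apply: periodic_int; first exact: cosD2pi.
by apply/to_circle_eq; exact: circle_liftK.
Qed.

Lemma csinE x : csin (to_circle x) = sin (pi *+ 2 * x).
Proof.
apply: periodic_int; first exact: sinD2pi.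
by apply/to_circle_eq; exact: circle_liftK.
Qed.

Lemma ccosD a b : ccos (a + b) = ccos a * ccos b - csin a * csin b.
Proof.
have [x <-] := to_circle_surj a; have [y <-] := to_circle_surj b.
by rewrite -to_circleD !ccosE !csinE mulrDr cosD.
Qed.

Lemma csinD a b : csin (a + b) = csin a * ccos b + ccos a * csin b.
Proof.
have [x <-] := to_circle_surj a; have [y <-] := to_circle_surj b.
by rewrite -to_circleD !ccosE !csinE mulrDr sinD.
Qed.

Lemma ccos0 : ccos 0 = 1.
Proof. by rewrite -to_circle0 ccosE mulr0 cos0. Qed.

Lemma ccosN a : ccos (- a) = ccos a.
Proof.
have [x <-] := to_circle_surj a; rewrite -[- _]add0r -to_circle0 -to_circleB.
by rewrite !ccosE sub0r mulrN cosN.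
Qed.

Lemma csinN a : csin (- a) = - csin a.
Proof.
have [x <-] := to_circle_surj a; rewrite -[- to_circle _]add0r -to_circle0 -to_circleB.
by rewrite !csinE sub0r mulrN sinN.
Qed.

Lemma ccosB a b : ccos (a - b) = ccos a * ccos b + csin a * csin b.
Proof. by rewrite ccosD ccosN csinN mulrN opprK. Qed.

Lemma ccos2Dcsin2 a : ccos a ^+ 2 + csin a ^+ 2 = 1.
Proof. exact: cos2Dsin2. Qed.

Lemma ccos_le1 a : ccos a <= 1. Proof. exact: cos_le1. Qed.
Lemma ccos_geN1 a : -1 <= ccos a. Proof. exact: cos_geN1. Qed.
Lemma ccos_max a : `|ccos a| <= 1. Proof. exact: cos_max. Qed.

Lemma continuous_ccos : continuous ccos.
Proof.
apply/(@quotient_continuous _ (Quotient.quot (Zint R))) => x.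
have -> : ccos \o \pi_(Quotient.quot (Zint R))%qT = (cos \o ( *%R (pi *+ 2))).
  by apply/funext => y /=; rewrite -ccosE.
apply: continuous_comp; first exact: mulrl_continuous.
exact: continuous_cos.
Qed.

Lemma circle_lift_itv a : exists2 x, `|x| <= 1/2 & to_circle x = a.
Proof.
have [y <-] := to_circle_surj a.
exists (y - (Num.floor (y + 1/2))%:~R).
  have := floor_itv (y + 1/2); rewrite intrD => /andP[h1 h2].
  by rewrite ler_norml; apply/andP; split; lra.
by apply/to_circle_eq; rewrite addrAC subrr add0r rpredN intr_int.
Qed.

Lemma two_pi_gt0 : 0 < pi *+ 2 :> R.
Proof. by rewrite mulrn_wgt0 // pi_gt0. Qed.

Lemma mem_half_turn x : 0 <= x <= 1/2 -> pi *+ 2 * x \in `[0, pi].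
Proof.
have pi0 := @pi_gt0 R.
by rewrite in_itv /= -mulr_natl => /andP[x0 x1]; apply/andP; split; nra.
Qed.

Lemma ccos_nbhs0 (W : set (circle R)) : nbhs 0 W ->
  exists2 d : R, 0 < d & forall a, 1 - ccos a < d -> W a.
Proof.
rewrite -to_circle0 => /(@to_circle_continuous R 0) /nbhs_ballP[e /= e0 eW].
have pi0 := @pi_gt0 R.
(* The cap 1/2 keeps [pi *+ 2 * e'] in [0, pi], where cosine is strictly decreasing. *)
pose e' := Num.min e (1/2); have e'0 : 0 < e' by rewrite lt_min e0; lra.
have e'1 : e' <= 1/2 by rewrite ge_min lexx orbT.
exists (1 - cos (pi *+ 2 * e')).
  rewrite subr_gt0 -[X in _ < X]cos0 -(mulr0 (pi *+ 2)) ltr_cos; last 2 first.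
  - by apply: mem_half_turn; apply/andP; split; lra.
  - by apply: mem_half_turn; apply/andP; split; lra.
  by rewrite ltr_pM2l // two_pi_gt0.
move=> a; have [x x1 <-] := circle_lift_itv a; rewrite ccosE => xe'.
have {xe'} : cos (pi *+ 2 * e') < cos (pi *+ 2 * `|x|).
  have -> : cos (pi *+ 2 * `|x|) = cos (pi *+ 2 * x).
    by rewrite -[RHS]cos_norm normrM [`|pi *+ 2|]ger0_norm // ltW // two_pi_gt0.
  lra.
rewrite ltr_cos; last 2 first.
- by apply: mem_half_turn; rewrite normr_ge0.
- by apply: mem_half_turn; apply/andP; split; lra.
rewrite ltr_pM2l ?two_pi_gt0 //.
by rewrite lt_min => /andP[xe _]; apply: eW; rewrite /ball /= sub0r normrN.
Qed.

Lemma ccos_eq1 a : ccos a = 1 -> a = 0.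
Proof.
have [x x1 <-] := circle_lift_itv a; rewrite ccosE => cx.
suff -> : x = 0 by rewrite to_circle0.
have pi0 := @pi_gt0 R.
have /cos_inj : cos (pi *+ 2 * `|x|) = cos (pi *+ 2 * 0).
  rewrite mulr0 cos0 -cx -[RHS]cos_norm normrM [`|pi *+ 2|]ger0_norm //.
  exact/ltW/two_pi_gt0.
move=> /(_ (mem_half_turn _) (mem_half_turn _)).
rewrite normr_ge0 lexx x1 => /(_ isT).
have -> : 0 <= 1/2 :> R by lra.
by move=> /(_ isT)/(mulfI (lt0r_neq0 two_pi_gt0))/normr0_eq0.
Qed.

Lemma ccos_lt1 a : a != 0 -> ccos a < 1.
Proof.
by move=> a0; rewrite lt_neqAle ccos_le1 andbT; apply: contra_neq a0 => /ccos_eq1.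
Qed.

Lemma compact_circle : compact [set: circle R].
Proof.
have -> : [set: circle R] = @to_circle R @` `[- (1/2), 1/2].
  apply/seteqP; split=> // a _; have [x] := circle_lift_itv a.
  by rewrite ler_norml => x1 <-; exists x; rewrite //= in_itv.
apply: continuous_compact; last exact: segment_compact.
exact: continuous_subspaceT (@to_circle_continuous R).
Qed.

Lemma cvg_circle0 (T : Type) (F : set_system T) (u : T -> circle R) :
  Filter F -> (u @ F --> (0 : circle R)) <-> (ccos \o u @ F --> (1 : R)).
Proof.
move=> FF; split=> [u0|u1 W /ccos_nbhs0[d d0 dW]].
  by rewrite -ccos0; apply: continuous_cvg; [exact: continuous_ccos|].
have := u1 _ (nbhsx_ballx (1 : R^o) _ d0); rewrite /nbhs /=; apply: filterS => t.
by rewrite /ball /= => ut; apply: dW; apply: le_lt_trans ut; exact: ler_norm.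
Qed.

Lemma hausdorff_circle : hausdorff_space (circle R).
Proof.
move=> p q pq; apply/eqP; rewrite -subr_eq0 -oppr_eq0 opprB; apply/eqP/ccos_eq1.
have gc : continuous (fun x : circle R => ccos (x - p)).
  move=> x; apply: continuous_comp; last exact: continuous_ccos.
  apply: (continuous_pair_comp (op := fun z : circle R * circle R => z.1 - z.2)
    (f := id) (g := fun=> p)) x; first exact: sub_continuous.
    by move=> x; exact: cvg_id.
  exact: cst_continuous.
have := cluster_continuous_eq (@Rhausdorff R) gc pq.
by rewrite subrr ccos0 => ->.
Qed.
End CircleCos.

(** * Large Fourier coefficients on a finite abelian group *)

Section FiniteFourier.
Variables (R : realType) (Q : finZmodType) (pair : Q -> Q -> circle R).
Hypothesis pairDl : forall k l n, pair (k + l) n = pair k n + pair l n.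
Hypothesis pairDr : forall k n m, pair k (n + m) = pair k n + pair k m.
Hypothesis pair_nondeg : forall n, n != 0 -> exists l, pair l n != 0.

Definition avg (f : Q -> R) : R := #|Q|%:R^-1 * \sum_n f n.

Let cardQ_gt0 : 0 < #|Q|%:R :> R.
Proof. by rewrite ltr0n; apply/card_gt0P; exists 0. Qed.

Let cardQ_neq0 : #|Q|%:R != 0 :> R.
Proof. exact: lt0r_neq0. Qed.

Lemma eq_avg f f' : f =1 f' -> avg f = avg f'.
Proof. by move=> ff'; congr (_ * _); exact: eq_bigr. Qed.

Lemma avgD f f' : avg (fun n => f n + f' n) = avg f + avg f'.
Proof. by rewrite /avg big_split mulrDr. Qed.

Lemma avgZ c f : avg (fun n => c * f n) = c * avg f.
Proof. by rewrite /avg -mulr_sumr mulrCA. Qed.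

Lemma avgZr c f : avg (fun n => f n * c) = avg f * c.
Proof. by rewrite /avg -mulr_suml mulrA. Qed.

Lemma avgB f f' : avg (fun n => f n - f' n) = avg f - avg f'.
Proof.
by rewrite /avg sumrB mulrBr.
Qed.

Lemma avg_cst c : avg (fun=> c) = c.
Proof. by rewrite /avg sumr_const -[c *+ _]mulr_natr mulrCA mulVf // mulr1. Qed.

Lemma le_avg f f' : (forall n, f n <= f' n) -> avg f <= avg f'.
Proof. by move=> ff'; rewrite ler_pM2l ?invr_gt0 //; exact: ler_sum. Qed.

Lemma avg_ge0 f : (forall n, 0 <= f n) -> 0 <= avg f.
Proof. by move=> f0; rewrite -(avg_cst 0); exact: le_avg. Qed.

Lemma sum_shift v (f : Q -> R) : \sum_n f (n + v) = \sum_n f n.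
Proof. by rewrite [RHS](reindex_inj (addIr v)). Qed.

Lemma avg_shift v f : avg (fun n => f (n + v)) = avg f.
Proof. by rewrite /avg sum_shift. Qed.

Lemma exchange_avg (f : Q -> Q -> R) :
  avg (fun n => avg (f n)) = avg (fun m => avg (f^~ m)).
Proof. by rewrite /avg -!mulr_sumr exchange_big. Qed.

Lemma avg_sum (f : Q -> Q -> R) :
  \sum_k avg (f k) = avg (fun n => \sum_k f k n).
Proof. by rewrite /avg -mulr_sumr exchange_big. Qed.

Lemma le_avg_sqr f : avg f ^+ 2 <= avg (fun n => f n ^+ 2).
Proof.
have : 0 <= avg (fun n => (f n - avg f) ^+ 2) by apply: avg_ge0 => n; exact: sqr_ge0.
rewrite (_ : avg _ = avg (fun n => f n ^+ 2 - 2 * avg f * f n + avg f ^+ 2)).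
  by rewrite avgD avgB avgZ avg_cst; lra.
by apply: eq_avg => n; lra.
Qed.

Local Notation cs k n := (ccos (pair k n)).
Local Notation sn k n := (csin (pair k n)).

Let pair0r k : pair k 0 = 0.
Proof. by apply: (addrI (pair k 0)); rewrite -pairDr !addr0. Qed.

Let pairNr k n : pair k (- n) = - pair k n.
Proof. by apply/eqP; rewrite -addr_eq0 -pairDr addNr pair0r. Qed.

Lemma ccos_mul (a b : circle R) : ccos a * ccos b = (ccos (a + b) + ccos (a - b)) / 2.
Proof. by rewrite ccosB ccosD; lra. Qed.

(** Orthogonality of characters. Averaging the shifts of [k] by [l] and [- l] multiplies each term
    by [cs l n] but leaves the sum unchanged; for [n != 0] some [l] makes this factor less than
    1. *)
Lemma sum_pair n : \sum_k cs k n = #|Q|%:R *+ (n == 0).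
Proof.
case: eqVneq => [->|/pair_nondeg[l ln]].
  rewrite (eq_bigr (fun=> 1)) ?sumr_const // => k _.
  by rewrite pair0r ccos0.
have : \sum_k cs k n * cs l n = \sum_k cs k n.
  rewrite (eq_bigr (fun k => (cs (k + l) n + cs (k - l) n) / 2)); last first.
    move=> k _; rewrite ccos_mul pairDl; congr ((_ + ccos _) / _).
    by apply: (addIr (pair l n)); rewrite -pairDl !subrK.
  rewrite -mulr_suml big_split /= (sum_shift l (fun k => cs k n)).
  rewrite (sum_shift (- l) (fun k => cs k n)).
  by lra.
rewrite -mulr_suml mulr0n => /eqP; rewrite -subr_eq0 -[X in _ - X]mulr1 -mulrBr.
rewrite mulf_eq0 => /orP[/eqP //|].
by rewrite subr_eq0 lt_eqF // ccos_lt1.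
Qed.

Variable g : Q -> R.
Hypothesis g01 : forall n, 0 <= g n <= 1.

Definition autocorr (v : Q) : R := avg (fun n => g n * g (n + v)).
Local Notation phi := autocorr.

Lemma autocorrN v : phi (- v) = phi v.
Proof.
rewrite /phi -(avg_shift v); apply: eq_avg => n.
by rewrite addrK mulrC.
Qed.

Lemma avg_autocorr : avg phi = avg g ^+ 2.
Proof.
rewrite /phi exchange_avg.
rewrite (eq_avg (f' := fun n => g n * avg g)) ?avgZr // => n.
by rewrite avgZ; congr (_ * _); rewrite -(avg_shift n g); apply: eq_avg => v; rewrite addrC.
Qed.

(** Since [phi] is even, this cosine average is its full Fourier coefficient. *)
Definition spectrum (k : Q) : R := avg (fun v => phi v * cs k v).
Local Notation A := spectrum.

(** [A k] is the squared modulus of the Fourier coefficient of [g] at [k]. *)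
Lemma spectrum_ge0 k : 0 <= A k.
Proof.
suff -> : A k = avg (fun n => g n * cs k n) ^+ 2 + avg (fun n => g n * sn k n) ^+ 2.
  by apply: addr_ge0; exact: sqr_ge0.
rewrite /A (eq_avg (f' := fun v => avg (fun n => g n * g (n + v) * cs k v))); last first.
  by move=> v; rewrite avgZr.
rewrite exchange_avg !expr2 -!avgZr -avgD; apply: eq_avg => n.
rewrite -(avg_shift (- n)).
rewrite -!avgZ -avgD; apply: eq_avg => m.
rewrite addrCA subrr addr0 pairDr pairNr ccosB; lra.
Qed.

(* The cosine addition formula moves the factor [cs k v] from the character to
   a translation of [phi], so no complex-valued transform is needed. *)
Lemma spectrum_mul k v :
  A k * cs k v = avg (fun w => (phi (w + v) + phi (w - v)) / 2 * cs k w).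
Proof.
rewrite /A -avgZr.
rewrite (eq_avg (f' := fun w => phi w * cs k (w + v) / 2 + phi w * cs k (w - v) / 2)); last first.
  by move=> w; rewrite -mulrA ccos_mul !pairDr pairNr; lra.
rewrite avgD -(avg_shift (- v) (fun w => _ * cs k (w + v) / 2)).
rewrite -(avg_shift v (fun w => _ * cs k (w - v) / 2)) -avgD.
by apply: eq_avg => w; rewrite subrK addrK; lra.
Qed.

(** Fourier inversion: orthogonality leaves only [w = 0], and evenness merges the two translates. *)
Lemma sum_spectrum_mul v : \sum_k A k * cs k v = phi v.
Proof.
under eq_bigr do rewrite spectrum_mul.
rewrite avg_sum (eq_avg (f' := fun w => (phi (w + v) + phi (w - v)) / 2 *
   (#|Q|%:R *+ (w == 0)))); last first.
  by move=> w; rewrite -mulr_sumr sum_pair.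
rewrite /avg (bigD1 0) //= big1 ?addr0 => [|w /negbTE ->]; last by rewrite mulr0.
by rewrite eqxx mulrCA mulr1n mulVf // mulr1 add0r sub0r autocorrN; lra.
Qed.

Lemma sum_spectrum_le1 : \sum_k A k <= 1.
Proof.
have <- : \sum_k A k * cs k 0 = \sum_k A k.
  by apply: eq_bigr => k _; rewrite pair0r ccos0 mulr1.
rewrite sum_spectrum_mul /phi -(avg_cst 1); apply: le_avg => n.
have /andP[? ?] := g01 n; have /andP[? ?] := g01 (n + 0).
by rewrite mulr_ile1.
Qed.

Lemma spectrum_le1 k : A k <= 1.
Proof.
apply: le_trans sum_spectrum_le1; rewrite (bigD1 k) //= lerDl.
by apply: sumr_ge0 => l _; exact: spectrum_ge0.
Qed.

(** Parseval for [phi] and its translate by [a]: one factor [A k] is expanded as an average, and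
    inversion evaluates the sum over [k]. *)
Lemma sum_spectrum_sqr a :
  \sum_k A k ^+ 2 * cs k a = avg (fun v => phi v * phi (v + a)).
Proof.
rewrite (eq_bigr (fun k => avg (fun v => phi v * ((A k * cs k (v + a) +
   A k * cs k (v - a)) / 2)))); last first.
  move=> k _; rewrite expr2 -mulrA {1}/A -avgZr; apply: eq_avg => v.
  by rewrite -mulrA (mulrCA (cs k v)) ccos_mul !pairDr pairNr; lra.
rewrite avg_sum (eq_avg (f' := fun v => phi v * phi (v + a) / 2 + phi v * phi (v - a) / 2)).
  rewrite avgD -(avg_shift a (fun v => phi v * phi (v - a) / 2)) -avgD.
  by apply: eq_avg => v; rewrite addrK; lra.
move=> v; rewrite -mulr_sumr -mulr_suml big_split /= !sum_spectrum_mul; lra.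
Qed.

(** The factor [1 - cs k v] turns [phi w] into [phi w] minus the mean of its translates by [v] and
    [- v], and each translate differs from [phi w] by at most [eta]. *)
Lemma spectrum_smooth k v (eta : R) :
  (forall n, `|g (n + v) - g n| <= eta) -> A k * (1 - cs k v) <= eta.
Proof.
move=> gv.
have phiv w u : (forall n, `|g (n + u) - g n| <= eta) -> phi w - phi (w + u) <= eta.
  move=> gu; rewrite /phi -avgB -[leRHS]avg_cst; apply: le_avg => n; rewrite -mulrBr.
  have /andP[g0 g1] := g01 n; have := gu (n + w); rewrite ler_norml addrA => /andP[? ?].
  apply: le_trans (_ : g n * eta <= _); last by nra.
  by apply: ler_wpM2l => //; lra.
have gNv n : `|g (n - v) - g n| <= eta by rewrite distrC -{1}(subrK v n).
have phiv' w u : (forall n, `|g (n + u) - g n| <= eta) -> `|phi w - phi (w + u)| <= eta.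
  move=> gu; rewrite ler_norml lerNl opprB phiv // andbT -{2}(addrK u w); apply: phiv => n.
  by rewrite distrC -{1}(subrK u n).
rewrite mulrBr mulr1 spectrum_mul -avgB -[leRHS]avg_cst; apply: le_avg => w.
rewrite -mulrBl; apply: le_trans (ler_norm _) _; rewrite normrM -[leRHS]mulr1.
apply: ler_pM => //; last exact: ccos_max.
have := phiv' w v gv; have := phiv' w (- v) gNv.
rewrite !ler_norml => /andP[? ?] /andP[? ?]; apply/andP; split; lra.
Qed.

(** By Parseval, the sum of [A k ^+ 2 * (1 - cs k a)] over all [k] is at least [avg g ^+ 4 - t].
    Coefficients below [e] contribute at most [2 * e], because the [A k] sum to at most 1; for the
    others [A k <= 1]. *)
Lemma large_spectrum (a : Q) (e t : R) :
  0 <= e -> avg (fun v => phi v * phi (v + a)) <= t ->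
  avg g ^+ 4 - t - 2 * e <= \sum_(k | e <= A k) (1 - cs k a).
Proof.
move=> e0 at_.
have h1 : avg g ^+ 4 - t <= \sum_k A k ^+ 2 * (1 - cs k a).
  have -> : \sum_k A k ^+ 2 * (1 - cs k a) =
      avg (fun v => phi v ^+ 2) - avg (fun v => phi v * phi (v + a)).
    rewrite -sum_spectrum_sqr.
    have -> : avg (fun v => phi v ^+ 2) = \sum_k A k ^+ 2 * cs k 0.
      by rewrite sum_spectrum_sqr; apply: eq_avg => v; rewrite addr0.
    by rewrite -sumrB; apply: eq_bigr => k _; rewrite pair0r ccos0 mulr1 mulrBr mulr1.
  apply: lerB => //; rewrite (exprM _ 2 2) -avg_autocorr; exact: le_avg_sqr.
have h2 : \sum_(k | ~~ (e <= A k)) A k ^+ 2 * (1 - cs k a) <= 2 * e.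
  apply: le_trans (_ : \sum_k A k * (2 * e) <= _); last first.
    by rewrite -mulr_suml ler_piMl // ?sum_spectrum_le1 //; lra.
  rewrite [leRHS](bigID (fun k => e <= A k)) /= -[leLHS]add0r; apply: lerD.
    by apply: sumr_ge0 => k _; rewrite mulr_ge0 ?spectrum_ge0 //; lra.
  apply: ler_sum => k; rewrite -ltNge => /ltW Ae.
  rewrite expr2 -mulrA ler_wpM2l ?spectrum_ge0 //.
  have := spectrum_ge0 k; have := ccos_geN1 (pair k a); have := ccos_le1 (pair k a); nra.
have h3 : \sum_(k | e <= A k) A k ^+ 2 * (1 - cs k a) <= \sum_(k | e <= A k) (1 - cs k a).
  apply: ler_sum => k _; rewrite ler_piMl ?subr_ge0 ?ccos_le1 //.
  by rewrite expr_le1 ?spectrum_ge0 ?spectrum_le1.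
move: h1; rewrite (bigID (fun k => e <= A k)) /=; lra.
Qed.

Lemma card_large_spectrum (e : R) : #|[pred k | e <= A k]|%:R * e <= 1.
Proof.
apply: le_trans sum_spectrum_le1; rewrite (bigID (fun k => e <= A k)) /=.
rewrite -[leLHS]addr0; apply: lerD; last by apply: sumr_ge0 => k _; exact: spectrum_ge0.
by rewrite mulr_natl -sumr_const; apply: ler_sum => k; rewrite inE.
Qed.
End FiniteFourier.

(** * Characters attached to an almost periodic function *)

Section AlmostPeriodic.
Variables (R : realType) (G : zmodType) (f : G -> R).

Definition almost_period (eta : R) (b : G) := forall y, `|f (y + b) - f y| <= eta.

(** Bochner's condition: the translates of [f] are totally bounded in the uniform norm. *)
Definition almost_periodic := forall eta, 0 < eta ->
  exists ys : seq G, forall y, exists2 y', y' \in ys & almost_period eta (y - y').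

Lemma almost_period0 : almost_period 0 0.
Proof. by move=> y; rewrite addr0 subrr normr0. Qed.

Lemma almost_periodN eta b : almost_period eta b -> almost_period eta (- b).
Proof. by move=> pb y; rewrite distrC -{1}(subrK b y). Qed.

Lemma almost_periodD eta eta' b b' :
  almost_period eta b -> almost_period eta' b' -> almost_period (eta + eta') (b + b').
Proof.
move=> pb pb' y; rewrite addrA [eta + _]addrC.
apply: le_trans (lerD (pb' (y + b)) (pb y)).
by rewrite -[f (y + b + b') - f y](subrKA (f (y + b))) ler_normD.
Qed.

Lemma almost_period_sum (I : Type) (r : seq I) eta (b : I -> G) :
  (forall i, almost_period eta (b i)) ->
  almost_period (eta *+ size r) (\sum_(i <- r) b i).
Proof.
move=> pb; elim: r => [|i r IH]; first by rewrite big_nil; exact: almost_period0.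
by rewrite big_cons mulrS; exact: almost_periodD.
Qed.

Lemma le_almost_period eta eta' b :
  eta <= eta' -> almost_period eta b -> almost_period eta' b.
Proof. by move=> le_eta pb y; exact: le_trans le_eta. Qed.

(** Pigeonhole: for some [n < m], the multiples [x i *+ n] and [x i *+ m] share a cell of the finite
    cover for every [i] at once, so [m - n] gives a common almost period. *)
Lemma almost_period_recurrence (I : finType) (x : I -> G) (eta : R) :
  almost_periodic -> 0 < eta ->
  exists N, forall i, almost_period eta (x i *+ N.+2).
Proof.
move=> apf eta0; have [|ys ysP] := apf (eta / 4); first lra.
pose s := (size ys).+1.
pose J (n : nat) : {ffun I -> 'I_s} :=
  [ffun i => inord (find (fun y' => `[< almost_period (eta / 4) (x i *+ n - y') >]) ys)].
have JP n i : almost_period (eta / 4) (x i *+ n - nth 0 ys (J n i)).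
  have [y' y'ys yy'] := ysP (x i *+ n).
  have hs : has (fun y' => `[< almost_period (eta / 4) (x i *+ n - y') >]) ys.
    by apply/hasP; exists y' => //; exact/asboolP.
  rewrite ffunE inordK ?ltnS ?find_size //; exact/asboolP/(nth_find 0 hs).
pose K := #|{ffun I -> 'I_s}|.
have [n [m [nm Jnm]]] : exists n m : nat, (n < m)%N /\ J n = J m.
  have /injectivePn[n [m nm Jnm]] : ~~ injectiveb (fun n : 'I_K.+1 => J n).
    by apply/negP => /injectiveP/leq_card; rewrite card_ord ltnn.
  have [lt_nm|lt_mn|/val_inj eq_nm] := ltngtP n m; [by exists n, m|by exists m, n|].
  by rewrite eq_nm eqxx in nm.
(* Doubling [m - n] makes the multiplier at least 2, as the form [N.+2] demands; hence the initial
   [eta / 4]. *)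
exists ((m - n) * 2 - 2)%N => i.
have -> : (((m - n) * 2 - 2).+2 = (m - n) + (m - n))%N.
  rewrite muln2 -addnn -addn2 subnK //; move: nm; rewrite -subn_gt0.
  by case: (m - n)%N => // k; rewrite addSn addnS.
have per : almost_period (eta / 4 + eta / 4) (x i *+ (m - n)).
  rewrite mulrnBr 1?ltnW // -(subrKA (nth 0 ys (J m i))) -[_ - x i *+ n]opprB.
  by apply: almost_periodD; [|rewrite -Jnm; apply: almost_periodN]; exact: JP.
by rewrite mulrnDr; apply: le_almost_period (almost_periodD per per); lra.
Qed.
End AlmostPeriodic.

(* The modulus has the form [M.+2] so that [1 : 'I_N] has value [1]. *)
Section RowPairing.
Variables (R : realType) (M r : nat).
Local Notation N := M.+2.
Local Notation Q := 'rV['I_N]_r.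

(** The standard self-duality of (Z/N)^r. *)
Definition row_pair (k n : Q) : circle R :=
  \sum_i to_circle ((k 0%R i * n 0%R i)%N%:R / N%:R).

Lemma row_pairC k n : row_pair k n = row_pair n k.
Proof. by apply: eq_bigr => i _; rewrite mulnC. Qed.

Lemma row_pairDr k n m : row_pair k (n + m) = row_pair k n + row_pair k m.
Proof.
rewrite -big_split /=; apply: eq_bigr => i _; rewrite mxE -to_circleD.
have N0 : (N%:R : R) != 0 by rewrite pnatr_eq0.
rewrite -[nat_of_ord (_ + _)%R]/((n 0%R i + m 0%R i) %% N)%N.
apply/to_circle_eq; rewrite -mulrDl -natrD -mulnDr.
have {2}-> : (n 0%R i + m 0%R i = (n 0%R i + m 0%R i) %/ N * N + (n 0%R i + m 0%R i) %% N)%N.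
  exact: divn_eq.
rewrite mulnDr natrD mulnA -mulrBl opprD addrCA subrr addr0.
by rewrite mulNr natrM mulfK // rpredN natr_int.
Qed.

Lemma row_pairDl k l n : row_pair (k + l) n = row_pair k n + row_pair l n.
Proof. by rewrite !(row_pairC _ n) row_pairDr. Qed.

Lemma row_pair0l n : row_pair 0 n = 0.
Proof. by apply: (addrI (row_pair 0 n)); rewrite -row_pairDl !addr0. Qed.

Lemma row_pair_nondeg n : n != 0 -> exists l, row_pair l n != 0.
Proof.
move=> n0; have [i ni0] : exists i, n 0%R i != 0.
  apply/existsP; apply: contraNT n0; rewrite negb_exists => /forallP n0.
  by apply/eqP/rowP => i; have := n0 i; rewrite negbK mxE => /eqP.
exists (delta_mx 0 i); rewrite /row_pair (bigD1 i) //= big1 ?addr0 => [|j /negbTE ji].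
  rewrite mxE !eqxx /= modn_small // mul1n.
  have nN := ltn_ord (n 0%R i); have {}ni0 : (0 < n 0%R i)%N by rewrite lt0n.
  have [q0 q1] : 0 < (n 0%R i)%:R / N%:R :> R /\ (n 0%R i)%:R / N%:R < 1 :> R.
    by rewrite divr_gt0 ?ltr0n // ltr_pdivrMr ?ltr0n // mul1r ltr_nat.
  apply/eqP; rewrite -to_circle0 => /to_circle_eq; rewrite subr0 => qi.
  by have := norm_intr_ge1 qi (lt0r_neq0 q0); rewrite ger0_norm ?(ltW q0) // leNgt q1.
by rewrite mxE ji andbF /= mul0n mul0r to_circle0.
Qed.

End RowPairing.

(** * Approximate homomorphisms from (Z/N)^r *)

Section RowEmbedding.
Variables (R : realType) (G : zmodType) (f : G -> R) (M r : nat) (x : 'I_r -> G).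
Local Notation N := M.+2.
Local Notation Q := 'rV['I_N]_r.

(** Residues are read as integers from 0 to N - 1, so additivity holds only up to multiples of the
    [x i *+ N]. *)
Definition row_embed (n : Q) : G := \sum_i x i *+ n 0%R i.

Lemma row_embed_delta i : row_embed (delta_mx 0 i) = x i.
Proof.
rewrite /row_embed (bigD1 i) //= big1 ?addr0 => [|j /negbTE ji].
  by rewrite mxE !eqxx /= modn_small.
by rewrite mxE ji andbF.
Qed.

(** Each coordinate carries 0 or 1 times N, so the defect is a sum of [r] terms, each 0 or
    [- (x i *+ N)]. *)
Lemma row_embedD (eta : R) n m :
  0 <= eta -> (forall i, almost_period f eta (x i *+ N)) ->
  almost_period f (eta *+ r) (row_embed (n + m) - (row_embed n + row_embed m)).
Proof.
move=> eta0 xN; rewrite -big_split -sumrB /=.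
rewrite -[r in _ *+ r]card_ord cardE -big_enum; apply: almost_period_sum => i.
rewrite mxE -[nat_of_ord (_ + _)%R]/((n 0%R i + m 0%R i) %% N)%N -mulrnDr.
have := divn_eq (n 0%R i + m 0%R i) N.
have : ((n 0%R i + m 0%R i) %/ N < 2)%N.
  by rewrite ltn_divLR // mul2n -addnn -addSn leq_add // ltnW.
case: (_ %/ _)%N => [|[|//]] _.
  rewrite mul0n add0n => ->; rewrite modn_mod subrr.
  exact: le_almost_period (almost_period0 f).
rewrite mul1n => {2}->; rewrite mulrnDr opprD addrCA subrr addr0.
exact: almost_periodN.
Qed.
End RowEmbedding.

(** * Approximate characters on finite subsets *)

Lemma approx_mul0 (R : realDomainType) (u u' w w' d t : R) :
  u <= 1 -> 0 <= w -> 0 <= w' <= 1 -> 0 <= d -> 3 * d <= t ->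
  u <= u' + d -> w <= w' + 2 * d -> 0 <= u -> u' * w' = 0 -> u * w <= t.
Proof.
move=> u1 w0 /andP[w'0 w'1] d0 dt uu ww u0 uw.
apply: le_trans dt; apply: le_trans (ler_wpM2l u0 ww) _; rewrite mulrDr.
have : u * w' <= (u' + d) * w' by exact: ler_wpM2r.
by rewrite mulrDl uw; nra.
Qed.

Section ApproximateCharacters.
Variables (R : realType) (G : zmodType) (f : G -> R).
Hypothesis apf : almost_periodic f.
Hypothesis f01 : forall y, 0 <= f y <= 1.
Hypothesis f0 : f 0 = 1.

(* For [f] supported in [U], this holds as soon as [a] is not in [U - U + U - U]. *)
Definition null_quadruples (a : G) :=
  forall y z w, f y * f (y + z) * (f w * f (w + z + a)) = 0.

(** The constants depend on [f] but not on [S] or [tau], so they survive a limit over all finite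
    sets. The piece of [G] spanned by [S] is modelled by (Z/N)^r and [f] by [g]; the [chi j] come
    from the large spectrum of [g]. *)
Lemma approximate_characters :
  exists (L : nat) (e d : R), [/\ 0 < e, 0 < d & forall (S : seq G) (tau : R), 0 < tau ->
    exists chi : 'I_L -> G -> circle R,
    [/\ forall j x y, x \in S -> y \in S -> x + y \in S ->
          e * (1 - ccos (chi j x + chi j y - chi j (x + y))) <= tau,
        forall j b eta, b \in S -> 0 <= eta -> almost_period f eta b ->
          e * (1 - ccos (chi j b)) <= eta + tau &
        forall a, a \in S -> null_quadruples a ->
          d <= \sum_j (1 - ccos (chi j a))]].
Proof.
have [|ys ysP] := apf (eta := 1/2); first lra.
have fys y : exists2 y', y' \in ys & 1/2 <= f (y - y').
  have [y' y'ys /(_ 0)] := ysP y; rewrite add0r f0 ler_norml => /andP[fy _].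
  by exists y' => //; lra.
have m0 : 0 < (size ys)%:R :> R.
  by have [y' y'ys _] := fys 0; rewrite ltr0n; case: (ys) y'ys.
(* Everywhere one of [m] translates of [g] will be at least 1/4, whence [c <= avg g]. With these
   values [c ^+ 4 - c ^+ 4 / 4 - 2 * e = d], and [L] bounds the number of coefficients that are at
   least [e]. *)
pose m : R := (size ys)%:R; pose c := (4 * m)^-1.
have c0 : 0 < c by rewrite invr_gt0; nra.
pose e := c ^+ 4 / 8; pose d := c ^+ 4 / 2; pose L := (Num.truncn e^-1).+1.
have c40 : 0 < c ^+ 4 by rewrite exprn_gt0.
have e0 : 0 < e by rewrite /e; lra.
have Le : 1 < L%:R * e by rewrite -ltr_pdivrMr // mul1r truncnS_gt.
exists L, e, d; split=> //; first by rewrite /d; lra.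
move=> S tau tau0; pose S' := 0 :: S ++ map -%R ys; pose r := (size (S ++ map -%R ys)).+1.
(* The three bounds serve the estimates up to [tau], the correlation bound [corr] and the lower
   bound [avg_g], in this order. *)
pose delta := Num.min (tau / 3) (Num.min (c ^+ 4 / 12) (1/4)).
have delta0 : 0 < delta by rewrite !lt_min; apply/and3P; split; lra.
have delta_tau : delta <= tau / 3 by rewrite ge_min lexx.
have delta_c : delta <= c ^+ 4 / 12 by rewrite !ge_min lexx orbT.
have delta_4 : delta <= 1/4 by rewrite !ge_min lexx !orbT.
pose x (i : 'I_r) := nth 0 S' i.
have [|M xN] := almost_period_recurrence x apf (eta := delta / r%:R).
  by rewrite divr_gt0 // ltr0n.
pose t := @row_embed G M r x; pose Q := 'rV['I_M.+2]_r.
have tD n n' : almost_period f delta (t (n + n') - (t n + t n')).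
  apply: le_almost_period (row_embedD _ _ _ xN).
    by rewrite -[leLHS]mulr_natr divfK // pnatr_eq0.
  by rewrite divr_ge0 // ltW.
pose E (s : G) : Q := delta_mx 0 (inord (index s S')).
have tE s : s \in S' -> t (E s) = s.
  move=> sS; have := sS; rewrite -index_mem => ls.
  by rewrite /t row_embed_delta /x inordK // nth_index.
pose g (n : Q) := f (t n).
have g01 n : 0 <= g n <= 1 by exact: f01.
have gD n v : `|g (n + v) - f (t n + t v)| <= delta.
  by have := tD n v (t n + t v); rewrite [_ + _ + (_ - _)]addrC subrK.
have gper v eta : almost_period f eta (t v) -> forall n, `|g (n + v) - g n| <= delta + eta.
  move=> pv n; rewrite -(subrKA (f (t n + t v))).
  by apply: le_trans (ler_normD _ _) _; apply: lerD.
have avg_g : c <= avg g.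
  have : 1/4 <= avg (fun n => \sum_(y' <- ys) g (n + E (- y'))).
    rewrite -[leLHS](@avg_cst R Q); apply: le_avg => n.
    have [y' y'ys fy'] := fys (t n).
    rewrite (big_rem y') //= -[leLHS]addr0; apply: lerD.
      have := gD n (E (- y')); rewrite tE.
        by rewrite ler_norml => /andP[]; lra.
      by rewrite inE mem_cat map_f ?orbT.
    by apply: sumr_ge0 => z _; have /andP[] := g01 (n + E (- z)).
  have -> : avg (fun n => \sum_(y' <- ys) g (n + E (- y'))) = m * avg g.
    rewrite /avg exchange_big /= (eq_bigr (fun=> \sum_n g n)); last first.
      by move=> y' _; rewrite sum_shift.
    by rewrite big_const_seq count_predT iter_addr_0 -[_ *+ size ys]mulr_natl [RHS]mulrCA.
  have -> : 1/4 = m * c by rewrite /c invfM mulrCA mulfV ?lt0r_neq0 // mulr1 mul1r.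
  by rewrite ler_pM2l.
pose A := spectrum (@row_pair R M r) g.
pose big := [pred k | e <= A k]; have AL : (#|big| <= L)%N.
  have := card_large_spectrum (@row_pairDl R M r) (@row_pairDr R M r) (@row_pair_nondeg R M r)
    g01 e.
  rewrite -/A => Ae; rewrite -(ler_nat R) -(ler_pM2r e0); lra.
(* Positions past the large spectrum are filled with 0, whose character is trivial. *)
pose k (j : 'I_L) : Q := nth 0 (enum big) j.
have kP j v eta : 0 <= eta -> (forall n, `|g (n + v) - g n| <= eta) ->
    e * (1 - ccos (row_pair R (k j) v)) <= eta.
  move=> eta0 gv; have [lt_j|ge_j] := ltnP j (size (enum big)).
    have : k j \in enum big by rewrite mem_nth.
    rewrite mem_enum inE => eA.
    have := spectrum_smooth (@row_pairDr R M r) g01 (k j) gv.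
    apply: le_trans.
    by rewrite ler_wpM2r // subr_ge0 ccos_le1.
  by rewrite /k nth_default // row_pair0l ccos0 subrr mulr0.
exists (fun j s => row_pair R (k j) (E s)); split.
- move=> j y z yS zS yzS.
  have S'S s : s \in S -> s \in S' by move=> sS; rewrite inE mem_cat sS orbT.
  pose v := E y + E z - E (y + z).
  have -> : row_pair R (k j) (E y) + row_pair R (k j) (E z) - row_pair R (k j) (E (y + z)) =
      row_pair R (k j) v.
    by apply: (addIr (row_pair R (k j) (E (y + z)))); rewrite -!row_pairDr !subrK.
  apply: kP; first exact: ltW.
  have -> : tau = tau / 3 + (tau / 3 + tau / 3) by lra.
  move=> n; apply: le_trans (gper v (delta + delta) _ n) _; last by lra.
  (* Adding [E (y + z)] back exhibits [t v] as a combination of two carry defects. *)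
  have tv : t v = - (t (v + E (y + z)) - (t v + t (E (y + z)))) +
      (t (E y + E z) - (t (E y) + t (E z))).
    by rewrite subrK !tE ?S'S // opprB subrKA addrK.
  by rewrite tv; apply: almost_periodD; [apply: almost_periodN|]; exact: tD.
- move=> j b eta bS eta0 pb; apply: kP; first by lra.
  have S'b : b \in S' by rewrite inE mem_cat bS orbT.
  have pb' : almost_period f eta (t (E b)) by rewrite tE.
  by move=> n; apply: le_trans (gper _ _ pb' n) _; lra.
move=> a aS na.
have S'a : a \in S' by rewrite inE mem_cat aS orbT.
have ta n : `|g (n + E a) - f (t n + a)| <= delta by have := gD n (E a); rewrite tE.
have corr : avg (fun v => autocorr g v * autocorr g (v + E a)) <= c ^+ 4 / 4.
  rewrite -[leRHS](@avg_cst R Q); apply: le_avg => v.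
  rewrite /autocorr -avgZr -[leRHS](@avg_cst R Q); apply: le_avg => n.
  rewrite -avgZ -[leRHS](@avg_cst R Q); apply: le_avg => n'.
  (* Up to multiples of [delta], the four values of [g] are values of [f] at [t n], [t n + t v],
     [t n'] and [t n' + t v + a], whose product vanishes. *)
  have h1 := gD n v; have h2 := ta (n' + v); rewrite -addrA in h2.
  have h3 := tD n' v (t n' + t v + a).
  rewrite [_ + (t (n' + v) - _)]addrC subrKA in h3.
  have h4 := na (t n) (t v) (t n').
  have /andP[? ?] := f01 (t n + t v); have /andP[? ?] := f01 (t n' + t v + a).
  have /andP[a0 a1] := g01 n; have /andP[b0 b1] := g01 (n + v).
  have /andP[c0' c1] := g01 n'; have /andP[? ?] := g01 (n' + (v + E a)).
  move: h1 h2 h3; rewrite !ler_norml => /andP[_ h1] /andP[_ h2] /andP[_ h3].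
  apply: (approx_mul0 (u' := g n * f (t n + t v))
    (w' := g n' * f (t n' + t v + a)) (d := delta)) => //.
  - exact: mulr_ile1.
  - exact: mulr_ge0.
  - by rewrite mulr_ge0 //= mulr_ile1.
  - exact: ltW.
  - lra.
  - apply: le_trans (_ : g n * (f (t n + t v) + delta) <= _).
      by rewrite ler_wpM2l //; lra.
    by rewrite mulrDr lerD2l ler_piMl // ltW.
  - apply: le_trans (_ : g n' * (f (t n' + t v + a) + 2 * delta) <= _).
      by rewrite ler_wpM2l //; lra.
    by rewrite mulrDr lerD2l ler_piMl //; lra.
  - exact: mulr_ge0.
have := large_spectrum (@row_pairDl R M r) (@row_pairDr R M r) (@row_pair_nondeg R M r)
  g01 (ltW e0) corr.
have g4 : c ^+ 4 <= avg g ^+ 4 by rewrite lerXn2r ?nnegrE // ltW // (lt_le_trans c0).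
have d4 : d <= c ^+ 4 - c ^+ 4 / 4 - 2 * e by rewrite /d /e; lra.
suff : \sum_(k | e <= spectrum (@row_pair R M r) g k) (1 - ccos (row_pair R k (E a))) <=
    \sum_j (1 - ccos (row_pair R (k j) (E a))) by lra.
rewrite -(big_mkord xpredT (fun j => 1 - ccos (row_pair R (enum big)`_j (E a)))).
have Ls : (size (enum big) <= L)%N by rewrite -cardE.
rewrite (big_cat_nat _ Ls) //= -(big_nth 0 xpredT (fun k => 1 - ccos (row_pair R k (E a)))).
rewrite big_enum /= lerDl; apply: sumr_ge0 => j _.
by rewrite subr_ge0 ccos_le1.
Qed.
End ApproximateCharacters.

(** * Exact characters as ultrafilter limits *)

Lemma ultra_cvg_compact (T : Type) (X : topologicalType) (U : set_system T) (u : T -> X) :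
  UltraFilter U -> compact [set: X] -> exists a : X, u t @[t --> U] --> a.
Proof.
move=> UU /(_ (u t @[t --> U]) _ filterT)[a [_ ua]]; exists a => W aW.
have [//|UWC] := in_ultra_setVsetC (u @^-1` W) UU.
by have [x []] := ua (~` W) W UWC aW.
Qed.

Lemma cvg_sumr (R : realType) (T I : Type) (F : set_system T) (r : seq I)
    (u : I -> T -> R) (l : I -> R) : Filter F ->
  (forall i, u i t @[t --> F] --> l i) ->
  \sum_(i <- r) u i t @[t --> F] --> \sum_(i <- r) l i.
Proof.
move=> FF ul; elim: r => [|i r IH].
  by rewrite big_nil; under eq_fun do rewrite big_nil; exact: cvg_cst.
by rewrite big_cons; under eq_fun do rewrite big_cons; exact: cvgD.
Qed.

Lemma cvg_le_eventually (R : realType) (T : Type) (F : set_system T) (u : T -> R) (l c : R) :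
  ProperFilter F -> u t @[t --> F] --> l ->
  (forall n : nat, \forall t \near F, u t <= c + n.+1%:R^-1) -> l <= c.
Proof.
move=> PF ul uc; rewrite leNgt; apply/negP => /ltr_add_invr[n].
apply/negP; rewrite -leNgt.
exact: (closed_cvg (fun x => x <= c + n.+1%:R^-1) (@closed_le R _) (uc n) l ul).
Qed.

Section LimitCharacters.
Variables (R : realType) (G : zmodType) (f : G -> R).
Hypothesis apf : almost_periodic f.
Hypothesis f01 : forall y, 0 <= f y <= 1.
Hypothesis f0 : f 0 = 1.

(** Stages are indexed by a finite list and a tolerance 1/(n+1). Along an ultrafilter containing all
    tails, the stage characters converge pointwise in the compact circle, and the tolerances
    disappear. *)
Lemma almost_periodic_characters :
  exists (L : nat) (e d : R) (chi : 'I_L -> G -> circle R), [/\ 0 < e, 0 < d,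
    forall j, {morph chi j : x y / x + y},
    forall j b eta, 0 <= eta -> almost_period f eta b -> e * (1 - ccos (chi j b)) <= eta &
    forall a, null_quadruples f a -> d <= \sum_j (1 - ccos (chi j a))].
Proof.
have [L [e [d [e0 d0 stage]]]] := approximate_characters apf f01 f0.
have /choice[chi chiP] : forall q : seq G * nat, exists chi : 'I_L -> G -> circle R,
    [/\ forall j x y, x \in q.1 -> y \in q.1 -> x + y \in q.1 ->
          e * (1 - ccos (chi j x + chi j y - chi j (x + y))) <= q.2.+1%:R^-1,
        forall j b eta, b \in q.1 -> 0 <= eta -> almost_period f eta b ->
          e * (1 - ccos (chi j b)) <= eta + q.2.+1%:R^-1 &
        forall a, a \in q.1 -> null_quadruples f a ->
          d <= \sum_j (1 - ccos (chi j a))].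
  by move=> [S n]; apply: stage; rewrite invr_gt0 ltr0n.
pose F := filter_from [set: seq G * nat]
  (fun p => [set q : seq G * nat | {subset p.1 <= q.1} /\ (p.2 <= q.2)%N]).
have FF : ProperFilter F.
  apply: filter_from_proper; last by move=> p _; exists p; split.
  apply: filter_from_filter; first by exists ([::], 0%N).
  move=> [S n] [S' n'] _ _; exists (S ++ S', maxn n n') => // -[S'' n''] /= [SS nn].
  split; split=> /=.
  - by move=> x xS; apply: SS; rewrite mem_cat xS.
  - exact: leq_trans (leq_maxl _ _) nn.
  - by move=> x xS; apply: SS; rewrite mem_cat xS orbT.
  - exact: leq_trans (leq_maxr _ _) nn.
have [U [UU FU]] := ultraFilterLemma FF.
have nearU (S : seq G) n : U [set q : seq G * nat | {subset S <= q.1} /\ (n <= q.2)%N].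
  by apply: FU; exists (S, n).
have /choice[psi psiP] : forall jx : 'I_L * G, exists a : circle R,
    chi q jx.1 jx.2 @[q --> U] --> a.
  move=> [j x].
  have [a ua] := ultra_cvg_compact (fun q => chi q j x) UU (@compact_circle R).
  by exists a.
have cvg_cos (u : seq G * nat -> circle R) a : u q @[q --> U] --> a ->
    e * (1 - ccos (u q)) @[q --> U] --> e * (1 - ccos a).
  move=> ua; apply: cvgMr; apply: cvgB; first exact: cvg_cst.
  by apply: continuous_cvg => //; exact: continuous_ccos.
have inv_le (n m : nat) : (n <= m)%N -> m.+1%:R^-1 <= n.+1%:R^-1 :> R.
  by move=> nm; rewrite lef_pV2 ?posrE ?ltr0n // ler_nat.
exists L, e, d, (fun j x => psi (j, x)); split=> //.
(* In the limit the additivity defect has [1 - ccos] at most 0, so it vanishes. *)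
- move=> j x y; apply/eqP; rewrite eq_sym -subr_eq0; apply/eqP/ccos_eq1.
  apply/eqP; rewrite eq_le ccos_le1 /= -subr_le0 -(pmulr_rle0 _ e0).
  pose u q := chi q j x + chi q j y - chi q j (x + y).
  have ua : u q @[q --> U] --> psi (j, x) + psi (j, y) - psi (j, x + y).
    apply: (continuous2_cvg _ (h := fun a b : circle R => a - b)).
    - exact: (@sub_continuous (circle R) (_, _)).
    - apply: (continuous2_cvg _ (h := fun a b : circle R => a + b)).
      + exact: (@add_continuous (circle R) (_, _)).
      + exact: psiP (j, x).
      + exact: psiP (j, y).
    - exact: psiP (j, x + y).
  apply: (cvg_le_eventually _ (cvg_cos _ _ ua)) => n.
  apply: filterS (nearU [:: x; y; x + y] n) => q [qS nq].
  have [+ _ _] := chiP q; rewrite add0r; move=> /(_ j x y) h.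
  apply: le_trans (inv_le _ _ nq); apply: h; apply: qS; rewrite !inE eqxx ?orbT //.
- move=> j b eta eta0 pb.
  apply: (cvg_le_eventually _ (cvg_cos _ _ (psiP (j, b)))) => n.
  apply: filterS (nearU [:: b] n) => q [qS nq].
  have [_ + _] := chiP q => /(_ j b eta (qS _ (mem_head _ _)) eta0 pb) /le_trans; apply.
  by rewrite lerD2l inv_le.
- move=> a na; rewrite -lerN2 -sumrN.
  have ua : \sum_j - (1 - ccos (chi q j a)) @[q --> U] --> \sum_j - (1 - ccos (psi (j, a))).
    apply: cvg_sumr => j; apply: cvgN; apply: cvgB; first exact: cvg_cst.
    by apply: continuous_cvg; [exact: continuous_ccos|exact: psiP (j, a)].
  apply: (cvg_le_eventually _ ua) => n.
  apply: filterS (nearU [:: a] n) => q [qS nq].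
  have [_ _ + ] := chiP q => /(_ a (qS _ (mem_head _ _)) na) h.
  by rewrite sumrN lerNl opprD opprK (le_trans _ h) // lerBlDr lerDl invr_ge0.
Qed.
End LimitCharacters.

(** * Characters of a group mapping into a compact group *)

Section TopologicalGroupNbhs.
Variable K : topologicalGroupType.
Implicit Types (W : set K) (k : K).
Local Open Scope group_scope.

Lemma continuous_mulg2 (T : topologicalType) (f g : T -> K) :
  continuous f -> continuous g -> continuous (fun t => f t * g t).
Proof. exact: continuous_pair_comp mulg_continuous. Qed.

Lemma continuous_invg (T : topologicalType) (f : T -> K) :
  continuous f -> continuous (fun t => (f t)^-1).
Proof. by move=> fc t; apply: continuous_comp; [exact: fc|exact: invg_continuous]. Qed.

Lemma nbhs1_mulg W : nbhs (1 : K) W ->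
  exists2 U, nbhs (1 : K) U & forall x y, U x -> U y -> W (x * y).
Proof.
move=> W1; have /= := @mulg_continuous K (1, 1) W.
rewrite /= mulg1 => /(_ W1)[[U V] [/= U1 V1] UVW].
exists (U `&` V); first exact: filterI.
by move=> x y [Ux _] [_ Vy]; exact: (UVW (x, y)).
Qed.

Lemma nbhs1_invg W : nbhs (1 : K) W -> nbhs (1 : K) [set x | W x^-1].
Proof. by move=> W1; apply: (@invg_continuous K 1); rewrite invg1. Qed.

Lemma nbhs1_divg W : nbhs (1 : K) W ->
  exists2 U, nbhs (1 : K) U & forall x y, U x -> U y -> W (x * y^-1).
Proof.
move=> /nbhs1_mulg[U U1 UW]; exists (U `&` [set x | U x^-1]).
  by apply: filterI => //; exact: nbhs1_invg.
by move=> x y [Ux _] [_ Uy]; exact: UW.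
Qed.

Lemma nbhs1_ldivg W : nbhs (1 : K) W ->
  exists2 U, nbhs (1 : K) U & forall x y, U x -> U y -> W (x^-1 * y).
Proof.
move=> /nbhs1_mulg[U U1 UW]; exists (U `&` [set x | U x^-1]).
  by apply: filterI => //; exact: nbhs1_invg.
by move=> x y [_ Ux] [Uy _]; exact: UW.
Qed.

Lemma nbhs_ltranslate k W : nbhs (1 : K) W -> nbhs k [set x | W (k^-1 * x)].
Proof.
move=> W1; have c : continuous (fun x : K => k^-1 * x).
  by apply: continuous_mulg2; [exact: cst_continuous|move=> x; exact: cvg_id].
by apply: (c k); rewrite mulVg.
Qed.

(** The bound holds near each [(k, 1)]; compactness in near-covering form yields one neighbourhood
    of 1 for all [k]. *)
Lemma compact_uniform_continuity (R : realType) (F : K -> R) (eta : R) :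
  compact [set: K] -> continuous F -> 0 < eta ->
  exists2 V, nbhs (1 : K) V & forall b, V b -> forall k, `|F (k * b) - F k| <= eta.
Proof.
move=> /compact_near_coveringP cK Fc eta0.
suff VF : nbhs (1 : K) [set b | [set: K] `<=` (fun k => `|F (k * b) - F k| <= eta)].
  by exists [set b | [set: K] `<=` (fun k => `|F (k * b) - F k| <= eta)] => // b Vb k; exact: Vb.
apply: (cK K (nbhs (1 : K)) (fun b k => `|F (k * b) - F k| <= eta)) => k _.
have c1 : continuous (fun p : K * K => F (p.1 * p.2)).
  by move=> p; apply: continuous_comp; [exact: mulg_continuous|exact: Fc].
have c2 : continuous (fun p : K * K => F p.1).
  by move=> p; apply: continuous_comp; [exact: cvg_fst|exact: Fc].
have c : continuous (fun p : K * K => F (p.1 * p.2) - F p.1 : R^o).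
  by move=> p; apply: cvgB; [exact: c1|exact: c2].
have /= := c (k, 1) _ (nbhsx_ballx _ _ eta0).
rewrite mulg1 subrr => h; apply: (@filterS _ (nbhs (k, 1 : K)) _ _ _ _ h) => -[k' b].
by rewrite /ball /= sub0r normrN => /ltW.
Qed.
End TopologicalGroupNbhs.

Lemma hom_continuous (R : realType) (G : topologicalZmodType) (chi : G -> circle R) :
  {morph chi : x y / x + y} ->
  (forall t, 0 < t -> \forall b \near (0 : G), 1 - ccos (chi b) < t) -> continuous chi.
Proof.
move=> chiD chi0 x W /= Wx.
have trc : continuous (fun a : circle R => chi x + a).
  apply: (continuous_pair_comp (f := fun=> chi x) (g := id) (@add_continuous (circle R))).
    exact: cst_continuous.
  by move=> a; exact: cvg_id.
have /ccos_nbhs0[t t0 tW] : nbhs (0 : circle R) [set a | W (chi x + a)].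
  by apply: (trc 0 W); rewrite /= addr0.
have subc : continuous (fun y : G => y - x).
  apply: (continuous_pair_comp (f := id) (g := fun=> x) (@sub_continuous G)).
    by move=> a; exact: cvg_id.
  exact: cst_continuous.
have : nbhs x [set y | 1 - ccos (chi (y - x)) < t].
  by apply: (subc x [set z | 1 - ccos (chi z) < t]); rewrite /= subrr; exact: chi0.
by apply: filterS => y /tW /=; rewrite -chiD addrC subrK.
Qed.

(** * Characters controlling a homomorphism into a compact group *)

Section CompactGroupCharacters.
Variables (R : realType) (G : topologicalZmodType) (K : topologicalGroupType).
Variable phi : G -> K.
Hypothesis phiD : forall x y, phi (x + y) = (phi x * phi y)%g.
Hypothesis phic : continuous phi.
Hypothesis chK : compact_hausdorff K.

Let cK : compact [set: K]. Proof. by case: chK. Qed.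
Let hK : hausdorff_space K. Proof. by case: chK. Qed.

Let phi0 : phi 0 = 1%g.
Proof. by apply: (@mulgI _ (phi 0)); rewrite -phiD addr0 mulg1. Qed.

Let phiN x : phi (- x) = (phi x)^-1%g.
Proof. by apply: (@mulgI _ (phi x)); rewrite -phiD subrr mulgV phi0. Qed.

Lemma hom_totally_bounded (W : set K) : nbhs 1%g W ->
  exists ys : seq G, forall y, exists2 y', y' \in ys & W (phi (y - y')).
Proof.
move=> /nbhs1_ldivg[V V1 VW].
(* Along the filter of lists ordered by inclusion, the near-covering property produces a finite
   list. *)
pose F := filter_from [set: seq G] (fun ys => [set ys' : seq G | {subset ys <= ys'}]).
have FF : ProperFilter F.
  apply: filter_from_proper; last by move=> ys _; exists ys.
  apply: filter_from_filter; first by exists [::].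
  move=> ys ys' _ _; exists (ys ++ ys') => // zs /= yszs.
  by split=> y yys; apply: yszs; rewrite mem_cat yys ?orbT.
have /compact_near_coveringP/(_ _ F
  (fun ys x => forall y, x = phi y -> exists2 y', y' \in ys & W (phi (y - y')))) := cK.
move=> /(_ _ _)/filter_ex[k _|ys ysP]; last by exists ys => y; exact: (ysP (phi y)).
(* If this translate of [V] misses the image of [phi], the default 0 is harmless, as the condition
   is then vacuous. *)
pose y_ := xget 0 [set y : G | V (k^-1 * phi y)%g].
exists ([set x | V (k^-1 * x)%g], [set ys | y_ \in ys]).
  split=> /=; first exact: nbhs_ltranslate.
  by exists [:: y_] => // ys; apply; exact: mem_head.
move=> [x ys] /= [Vx yys] y xy; exists y_ => //; rewrite {}xy in Vx.
have Vy : V (k^-1 * phi y_)%g.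
  by apply: (xgetPex 0 (P := [set y : G | V (k^-1 * phi y)%g])); exists y.
rewrite addrC phiD phiN.
by have := VW _ _ Vy Vx; rewrite invgM invgK -mulgA mulVKg.
Qed.

(** Used twice: to separate the points of [G], and to show that the closed graph over [bohr] is
    functional. *)
Lemma compact_group_characters (W : set K) : nbhs 1%g W ->
  exists (L : nat) (d : R) (chi : 'I_L -> G -> circle R), [/\ 0 < d,
    forall j, pontryagin_dual (chi j) &
    forall a, ~ W (phi a) -> d <= \sum_j (1 - ccos (chi j a))].
Proof.
move=> /nbhs1_mulg[W' W'1 W'W]; have [U U1 UW'] := nbhs1_divg W'1.
(* Compact Hausdorff spaces are normal, so Urysohn's lemma separates 1 from the complement of the
   interior of [U]. *)
have [F [Fc F01 F0 F1]] : exists F : K -> R, [/\ continuous F, range F `<=` `[0, 1],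
    F @` (~` interior U) `<=` [set 0] & F @` [set 1%g] `<=` [set 1]].
  apply/uniform_separatorP.
  apply: (iffLR (@normal_separatorP R K) (compact_normal hK cK)).
  - by apply: open_closedC; exact: open_interior.
  - exact: accessible_closed_set1 (hausdorff_accessible hK) _.
  - by rewrite -subset0 => x [/= + x1]; apply; rewrite x1.
pose f y := F (phi y).
have f01 y : 0 <= f y <= 1.
  by have := F01 (f y) (imageP _ I); rewrite /= in_itv.
have f0 : f 0 = 1 by rewrite /f phi0; apply: (F1 (F 1%g)); exists 1%g.
have fU y : f y != 0 -> U (phi y).
  move=> fy; apply: interior_subset; apply: contrapT => nU; move/eqP: fy; apply.
  by apply: (F0 (f y)); exists (phi y).
have per eta : 0 < eta ->
    exists2 V, nbhs (1%g : K) V & forall b, V (phi b) -> almost_period f eta b.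
  move=> /(compact_uniform_continuity cK Fc)[V V1 VF]; exists V => // b Vb y.
  by rewrite /f phiD; exact: VF.
have apf : almost_periodic f.
  move=> eta /per[V V1 Vper]; have [ys ysP] := hom_totally_bounded V1.
  by exists ys => y; have [y' y'ys Vy] := ysP y; exists y' => //; exact: Vper.
have [L [e [d [chi [e0 d0 chiD chi_per chi_d]]]]] := almost_periodic_characters apf f01 f0.
exists L, d, chi; split=> // [j|a nWa]; last first.
  apply: chi_d => y z w; apply/eqP; apply: contra_notT nWa.
  rewrite !mulf_eq0 !negb_or => /andP[/andP[/fU Uy /fU Uyz] /andP[/fU Uw /fU Uwza]].
  (* A nonzero product would place [phi a] in U U^-1 U U^-1, hence in [W]; the rearrangement uses
     that [G] is abelian. *)
  have -> : phi a = ((phi (w + z + a) * (phi w)^-1) * (phi y * (phi (y + z))^-1))%g.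
    rewrite -!phiN -!phiD; congr phi.
    by rewrite opprD [y + (_ - _)]addrA subrr sub0r -addrA -opprD [w + z + a]addrC addrK.
  by apply: W'W; exact: UW'.
split=> //; apply: hom_continuous => // t t0.
have et0 : 0 < e * t / 2 by rewrite divr_gt0 // mulr_gt0.
have [V V1 Vper] := per _ et0.
have : nbhs (0 : G) (phi @^-1` V) by apply: phic; rewrite phi0.
apply: filterS => b /Vper /(chi_per j _ _ (ltW et0)); rewrite -mulrA ler_pM2l //.
by move=> h; apply: le_lt_trans h _; lra.
Qed.
End CompactGroupCharacters.

(** * Kronecker's approximation theorem *)

Lemma sumr_ge_const (R : numDomainType) (T : finType) (F : T -> R) c :
  (forall i, c <= F i) -> c *+ #|T| <= \sum_i F i.
Proof. by move=> cF; rewrite -sumr_const; apply: ler_sum => i _; exact: cF. Qed.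

(** Write [rho = s * s]. One [s ^+ N] absorbs a factor [N.+1], as [N.+1%:R * s ^+ N] is at most a
    geometric sum; induction treats the rest. *)
Lemma pow_geometric_bounded (R : realType) (k : nat) (rho : R) : 0 <= rho < 1 ->
  exists2 C, 0 < C & forall N : nat, N.+1%:R ^+ k * rho ^+ N <= C.
Proof.
elim: k rho => [|k IH] rho /andP[rho0 rho1].
  exists 1 => // N; rewrite mul1r; exact: exprn_ile1 (ltW rho1).
pose s := Num.sqrt rho.
have s0 : 0 <= s := sqrtr_ge0 rho.
have s1 : s < 1 by rewrite -sqrtr1 ltr_sqrt.
have [|C C0 CP] := IH s; first by rewrite s0.
have lin N : N.+1%:R * s ^+ N <= (1 - s)^-1.
  rewrite -[leRHS]mul1r ler_pdivlMr ?subr_gt0 //.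
  have sN : N.+1%:R * s ^+ N <= \sum_(i < N.+1) s ^+ i.
    rewrite mulr_natl -[N.+1 in leLHS]card_ord; apply: sumr_ge_const => i.
    by apply: ler_wiXn2l => //; [exact: ltW|rewrite -ltnS].
  apply: le_trans (_ : (1 - s) * \sum_(i < N.+1) s ^+ i <= _).
    by rewrite mulrC ler_wpM2l // subr_ge0 ltW.
  by rewrite -opprB mulNr -subrX1 opprB gerBl exprn_ge0.
exists (C * (1 - s)^-1) => [|N]; first by rewrite mulr_gt0 // invr_gt0 subr_gt0.
have -> : rho ^+ N = s ^+ N * s ^+ N by rewrite -(sqr_sqrtr rho0) -exprM mulnC exprM expr2.
rewrite exprSr mulrACA; apply: ler_pM => //; rewrite ?mulr_ge0 ?exprn_ge0 //.
Qed.

Lemma pow_geometric_small (R : realType) (k : nat) (rho d : R) : 0 <= rho < 1 -> 0 < d ->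
  exists N : nat, N.+1%:R ^+ k * rho ^+ N < d.
Proof.
move=> /(pow_geometric_bounded k.+1)[C C0 CP] d0.
exists (Num.truncn (C / d)); set N := Num.truncn _.
have N0 : 0 < N.+1%:R :> R by rewrite ltr0n.
rewrite -(ltr_pM2l N0) mulrA -exprS; apply: le_lt_trans (CP N) _.
by rewrite -ltr_pdivrMr // truncnS_gt.
Qed.

(** Cauchy-Schwarz, from the sum of squared deviations from the mean [S / n]. *)
Lemma sqr_sum_le (R : realFieldType) (T : finType) (f : T -> R) :
  (\sum_i f i) ^+ 2 <= #|T|%:R * \sum_i f i ^+ 2.
Proof.
set S := \sum_i f i; set S2 := \sum_i f i ^+ 2; set n : R := #|T|%:R.
have expand c : \sum_i (f i - c) ^+ 2 = S2 - 2 * c * S + c ^+ 2 * n.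
  rewrite /S2 /S /n mulr_sumr -sumrB -[in RHS]sum1_card natr_sum mulr_sumr -big_split /=.
  by apply: eq_bigr => i _; lra.
have sq c : 0 <= S2 - 2 * c * S + c ^+ 2 * n.
  by rewrite -expand; apply: sumr_ge0 => i _; exact: sqr_ge0.
have [n0|n0] := eqVneq n 0.
  have T0 : #|T| = 0%N by apply/eqP; rewrite -(eqr_nat R) -/n n0.
  rewrite /S big1 ?expr0n ?mulr_ge0 ?n0 //; last by move=> i; have := fintype0 i T0.
  by apply: sumr_ge0 => i _; exact: sqr_ge0.
have n_gt0 : 0 < n by rewrite lt0r n0 ler0n.
have := sq (S / n); rewrite -(pmulr_rge0 _ n_gt0).
have -> : n * (S2 - 2 * (S / n) * S + (S / n) ^+ 2 * n) = n * S2 - S ^+ 2; last lra.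
have nK : S / n * n = S by rewrite divfK.
move: (S / n) nK => c nK; rewrite -nK; lra.
Qed.

(** Cauchy-Schwarz for the fibre sizes [m v] of [h], whose squares add up to the number of colliding
    pairs. *)
Lemma collision_count (R : realFieldType) (T : finType) (I : Type) (W : seq I) (h : I -> T) :
  (size W)%:R ^+ 2 <= #|T|%:R * \sum_(w <- W) \sum_(w' <- W) (h w == h w')%:R :> R.
Proof.
pose m v : R := \sum_(w <- W) (h w == v)%:R.
have sumE (a : T) (F : T -> R) : \sum_v (a == v)%:R * F v = F a.
  rewrite (bigD1 a) //= eqxx mul1r big1 ?addr0 // => v.
  by rewrite eq_sym => /negbTE ->; rewrite mul0r.
have -> : (size W)%:R = \sum_v m v.
  rewrite exchange_big /= -sum1_size natr_sum; apply: eq_bigr => w _.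
  by rewrite -[LHS](sumE (h w) (fun=> 1)); apply: eq_bigr => v _; rewrite mulr1.
have -> : \sum_(w <- W) \sum_(w' <- W) (h w == h w')%:R = \sum_v m v ^+ 2.
  under [RHS]eq_bigr => v _ do rewrite expr2 mulr_suml.
  rewrite [RHS]exchange_big /=; apply: eq_bigr => w _.
  rewrite (sumE (h w) m); apply: eq_bigr => w' _.
  by rewrite eq_sym.
exact: sqr_sum_le.
Qed.

(** Both sides are the squared modulus of the sum of the exp(2 pi i [a i]). *)
Lemma sum_ccos_sub (R : realType) (I : Type) (r : seq I) (a : I -> circle R) :
  \sum_(i <- r) \sum_(j <- r) ccos (a i - a j) =
  (\sum_(i <- r) ccos (a i)) ^+ 2 + (\sum_(i <- r) csin (a i)) ^+ 2.
Proof.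
rewrite !expr2 !mulr_suml -big_split /=; apply: eq_bigr => i _.
by rewrite !mulr_sumr -big_split /=; apply: eq_bigr => j _; rewrite ccosB.
Qed.

(** * Words and powers of trigonometric sums *)

Section Words.
Variable J : finType.

Fixpoint words (N : nat) : seq (seq J) :=
  if N is N'.+1 then [seq j :: w | j <- enum J, w <- words N'] else [:: [::]].

Lemma size_words N : size (words N) = (#|J| ^ N)%N.
Proof. by elim: N => // N IH; rewrite /= size_allpairs IH expnS -cardE. Qed.

Lemma mem_words N w : w \in words N -> size w = N.
Proof.
elim: N w => [|N IH] w; first by rewrite inE => /eqP ->.
by move=> /allpairsP[[j w'] /= [_ /IH <- ->]].
Qed.

Lemma sum_words (R : nmodType) N (F : seq J -> R) :
  \sum_(w <- words N.+1) F w = \sum_j \sum_(w <- words N) F (j :: w).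
Proof. by rewrite /= big_allpairs_dep big_enum. Qed.

Lemma sum_word_counts (V : nmodType) (x : J -> V) w :
  \sum_(j <- w) x j = \sum_j x j *+ count_mem j w.
Proof.
elim: w => [|j w IH]; first by rewrite big_nil big1.
rewrite big_cons IH /=; under [RHS]eq_bigr => k _ do rewrite mulrnDr.
rewrite big_split /=; congr (_ + _).
rewrite (bigD1 j) //= eqxx mulr1n big1 ?addr0 // => k.
by rewrite eq_sym => /negbTE ->; rewrite mulr0n.
Qed.

(** The [N]-th power of a sum of unit complex numbers expands over the words of length [N]; both
    sides are the squared modulus of that power. *)
Lemma ccos_words (R : realType) (theta : J -> circle R) N :
  \sum_(w <- words N) \sum_(w' <- words N)
     ccos (\sum_(j <- w) theta j - \sum_(j <- w') theta j) =
  (\sum_i \sum_j ccos (theta i - theta j)) ^+ N.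
Proof.
rewrite !sum_ccos_sub; set c := \sum_j ccos (theta j); set s := \sum_j csin (theta j).
pose D w := \sum_(j <- w) theta j.
have cS n : \sum_(w <- words n.+1) ccos (D w) =
    c * (\sum_(w <- words n) ccos (D w)) - s * (\sum_(w <- words n) csin (D w)).
  rewrite sum_words !mulr_suml -sumrB; apply: eq_bigr => j _.
  rewrite !mulr_sumr -sumrB; apply: eq_bigr => w _.
  by rewrite /D big_cons ccosD.
have sS n : \sum_(w <- words n.+1) csin (D w) =
    s * (\sum_(w <- words n) ccos (D w)) + c * (\sum_(w <- words n) csin (D w)).
  rewrite sum_words !mulr_suml -big_split; apply: eq_bigr => j _.
  rewrite !mulr_sumr -big_split; apply: eq_bigr => w _.
  by rewrite /D big_cons csinD.
elim: N => [|N IH].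
  by rewrite !big_seq1 !big_nil ccos2Dcsin2 expr0.
rewrite [RHS]exprS -IH (cS N) (sS N) -/(D _).
by move: (\sum_(w <- _) ccos _) (\sum_(w <- _) csin _) => a b; lra.
Qed.
End Words.

(** * Density for a separating family of characters closed under addition *)

Section Kronecker.
Variables (R : realType) (G : zmodType) (A : set (G -> circle R)).
Hypothesis A_hom : forall chi, A chi -> {morph chi : x y / x + y}.
Hypothesis A0 : A (fun=> 0).
Hypothesis AD : forall chi psi, A chi -> A psi -> A (fun x => chi x + psi x).
Hypothesis A_sep : forall y, y != 0 -> exists2 chi, A chi & chi y != 0.

(** Multiplication by [2 * (1 - ccos theta)] turns each cosine into [d j - d j.+1]; the sum
    telescopes to [d 0 - d N], which is at least -4. *)
Lemma sum_ccos_progression (theta q : circle R) N :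
  - 2 <= (1 - ccos theta) * \sum_(0 <= j < N) ccos (theta *+ j + q).
Proof.
pose d j := ccos (theta *+ j + q) - ccos (theta *+ j + q - theta).
have dE j : 2 * (1 - ccos theta) * ccos (theta *+ j + q) = d j - d j.+1.
  rewrite /d (mulrSr theta j) [theta *+ j + _ + q]addrAC addrK.
  by move: (theta *+ j + q) => a; rewrite ccosB ccosD; lra.
have : 2 * ((1 - ccos theta) * \sum_(0 <= j < N) ccos (theta *+ j + q)) = d 0%N - d N.
  rewrite mulrA mulr_sumr; under eq_bigr do rewrite dE.
  by rewrite -[LHS]opprK -sumrN; under eq_bigr do rewrite opprB; rewrite telescope_sumr // opprB.
have := ccos_le1 (theta *+ N + q); have := ccos_geN1 (theta *+ N + q - theta).
have := ccos_geN1 (theta *+ 0 + q); have := ccos_le1 (theta *+ 0 + q - theta).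
by rewrite /d; lra.
Qed.

(** A finite substitute for Haar measure on the dual, under which nontrivial characters have mean 0.
    For a new [y], the multiples of a character [b] with [b y != 0] are added to every member; the
    arbitrary phase [q] preserves the earlier bounds. *)
Lemma averaging_family (ys : seq G) (eta : R) :
  0 < eta -> {in ys, forall y, y != 0} ->
  exists (I : finType) (chi : I -> G -> circle R), [/\ (0 < #|I|)%N, forall i, A (chi i) &
    {in ys, forall y q, - eta *+ #|I| <= \sum_i ccos (chi i y + q)}].
Proof.
move=> eta0; elim: ys => [|y ys IH] ys0.
  by exists unit, (fun _ _ => 0); split=> //; rewrite card_unit.
have [|I [chi [I0 chiA chiP]]] := IH.
  by move=> z zys; apply: ys0; rewrite inE zys orbT.
have [b Ab by0] := A_sep (ys0 _ (mem_head _ _)).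
have b1 : 0 < 1 - ccos (b y) by rewrite subr_gt0 ccos_lt1.
(* Chosen so that the progression bound [2 / (1 - ccos (b y))] is at most [eta * N%:R]. *)
pose N := (Num.truncn (2 / (eta * (1 - ccos (b y))))).+1.
have NP : 2 <= eta * N%:R * (1 - ccos (b y)).
  by rewrite mulrAC mulrC -ler_pdivrMr ?mulr_gt0 // ltW // truncnS_gt.
exists ((I * 'I_N)%type : finType), (fun (ij : I * 'I_N) x => b x *+ ij.2 + chi ij.1 x); split.
- by rewrite card_prod card_ord muln_gt0 I0.
- move=> [i j] /=; elim: (j : nat) => [|m IHm].
    by under eq_fun do rewrite mulr0n add0r; exact: chiA.
  by under eq_fun do rewrite mulrS -addrA; exact: AD.
move=> z; rewrite inE => zP q.
rewrite -(pair_bigA _ (fun i (j : 'I_N) => ccos (b z *+ j + chi i z + q))) /=.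
rewrite card_prod card_ord; case/predU1P: zP => [->|zys]; last first.
  rewrite exchange_big /= mulrnA -[N in leLHS]card_ord.
  apply: sumr_ge_const => j; apply: le_trans (chiP z zys (b z *+ j + q)) _.
  by apply: ler_sum => i _; rewrite addrCA addrA.
rewrite mulnC mulrnA; apply: sumr_ge_const => i.
have := sum_ccos_progression (b y) (chi i y + q) N.
have -> : \sum_(0 <= j < N) ccos (b y *+ j + (chi i y + q)) =
    \sum_(j < N) ccos (b y *+ j + chi i y + q).
  by rewrite big_mkord; apply: eq_bigr => j _; rewrite addrA.
set S := \sum_(_ < _) _ => hS; rewrite -(ler_pM2l b1) -[_ *+ N]mulr_natr; nra.
Qed.

(* If no [chi] were close to [p], then [C chi], the squared modulus of the sum of the
   [chi (x j) - p j] seen as unit complex numbers, would stay below [rho * #|J| ^ 2]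
   with [rho < 1]. The mean of [C chi ^ N] over [chi] would then be at most
   [rho ^ N * #|J| ^ (2 * N)]; but it counts the pairs of words of length [N] with equal
   sums, and since these sums take at most [N.+1 ^ #|J|] values, there are at least
   [#|J| ^ (2 * N) / N.+1 ^ #|J|] such pairs. *)
Lemma kronecker_density (J : finType) (x : J -> G) (p : J -> circle R) (j0 : J) (eps : R) :
  x j0 = 0 -> p j0 = 0 ->
  (forall n : J -> int, \sum_j x j *~ n j = 0 -> \sum_j p j *~ n j = 0) ->
  0 < eps ->
  exists2 chi, A chi & forall j, 1 - ccos (chi (x j) - p j) < eps.
Proof.
move=> x0 p0 rel eps0; apply: contrapT => nex.
have far chi : A chi -> exists j, eps <= 1 - ccos (chi (x j) - p j).
  move=> Achi; apply: contrapT => nj; apply: nex; exists chi => // j.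
  by rewrite ltNge; apply/negP => le_eps; apply: nj; exists j.
pose theta (chi : G -> circle R) j := chi (x j) - p j.
pose n : R := #|J|%:R; pose rho := 1 - eps / n ^+ 2.
pose C (chi : G -> circle R) := \sum_i \sum_j ccos (theta chi i - theta chi j).
have n0 : 0 < n by rewrite ltr0n; apply/card_gt0P; exists j0.
have n20 : 0 < n ^+ 2 by rewrite exprn_gt0.
have C_ge0 chi : 0 <= C chi.
  by rewrite /C sum_ccos_sub addr_ge0 ?sqr_ge0.
have hom0 chi : A chi -> chi 0 = 0.
  by move=> /A_hom chiD; apply: (addrI (chi 0)); rewrite -chiD !addr0.
have C_le chi : A chi -> C chi <= rho * n ^+ 2.
  move=> Achi; have [j ej] := far chi Achi.
  have -> : rho * n ^+ 2 = n ^+ 2 - eps by rewrite mulrBl mul1r divfK // gt_eqF.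
  have : \sum_i \sum_k (1 - ccos (theta chi i - theta chi k)) = n ^+ 2 - C chi.
    rewrite /C; under eq_bigr => i _ do rewrite sumrB.
    by rewrite sumrB !sumr_const -mulrnA natrM -expr2.
  suff : eps <= \sum_i \sum_k (1 - ccos (theta chi i - theta chi k)) by lra.
  (* Since [theta chi j0 = 0], the pair [(j, j0)] alone costs [eps]. *)
  apply: le_trans ej _; rewrite (bigD1 j) //= (bigD1 j0) //=.
  rewrite {2}/theta x0 p0 hom0 // !subr0 -addrA lerDl addr_ge0 //.
    by apply: sumr_ge0 => k _; rewrite subr_ge0 ccos_le1.
  by apply: sumr_ge0 => i _; apply: sumr_ge0 => k _; rewrite subr_ge0 ccos_le1.
have rho01 : 0 <= rho < 1.
  have := le_trans (C_ge0 _) (C_le _ A0); rewrite pmulr_lge0 // => -> /=.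
  by rewrite /rho gtrBl divr_gt0.
have [|N NP] := pow_geometric_small #|J| rho01 (d := 1/2); first lra.
pose V := {ffun J -> 'I_N.+1}; pose W := words J N.
have cardV : #|V|%:R = N.+1%:R ^+ #|J| :> R by rewrite card_ffun card_ord natrX.
have V0 : 0 < #|V|%:R :> R by rewrite cardV exprn_gt0.
(* Letter counts in [W] are at most [N], so [inord] loses nothing there. *)
pose h (w : seq J) : V := [ffun j => inord (count_mem j w)].
pose t (w : seq J) := \sum_(j <- w) x j; pose P (w : seq J) := \sum_(j <- w) p j.
have tE w : t w = \sum_j x j *+ count_mem j w by exact: sum_word_counts.
have PE w : P w = \sum_j p j *+ count_mem j w by exact: sum_word_counts.
have ht w w' : w \in W -> w' \in W -> h w = h w' -> t w = t w'.
  move=> /mem_words wW /mem_words w'W hw.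
  have cw j : count_mem j w = count_mem j w'.
    move/ffunP/(_ j): hw; rewrite !ffunE => /(congr1 val) /=.
    rewrite !inordK // ltnS; first by rewrite -w'W count_size.
    by rewrite -wW count_size.
  by rewrite !tE; under eq_bigr => j _ do rewrite cw.
have sumB (V' : zmodType) (y : J -> V') w w' :
    \sum_j y j *+ count_mem j w - \sum_j y j *+ count_mem j w' =
    \sum_j y j *~ ((count_mem j w)%:Z - (count_mem j w')%:Z).
  rewrite -sumrB; under [RHS]eq_bigr => j _ do rewrite mulrzBr.
  by [].
have tP w w' : t w = t w' -> P w = P w'.
  move=> tw; apply/eqP; rewrite -subr_eq0 !PE sumB; apply/eqP/rel.
  by rewrite -sumB -!tE tw subrr.
pose ys := [seq y <- [seq t w - t w' | w <- W, w' <- W] | y != 0].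
(* With this value the total error [eta * (size W)%:R ^+ 2] is at most half the number of
   collisions. *)
pose eta : R := (2 * #|V|%:R)^-1.
have eta0 : 0 < eta by rewrite invr_gt0 mulr_gt0.
have [|I [chi [I0 Achi avg_ys]]] := @averaging_family ys eta eta0.
  by move=> y; rewrite mem_filter => /andP[].
pose D i (w : seq J) := \sum_(j <- w) theta (chi i) j.
have chi_sum i w : chi i (t w) = \sum_(j <- w) chi i (x j).
  by rewrite /t (big_morph _ (A_hom (Achi i)) (hom0 _ (Achi i))).
have DE i w w' : D i w - D i w' = chi i (t w - t w') + (P w' - P w).
  have -> : chi i (t w - t w') = chi i (t w) - chi i (t w').
    by apply: (addIr (chi i (t w'))); rewrite -(A_hom (Achi i)) !subrK.
  by rewrite /D /theta !sumrB -!chi_sum -/(P w) -/(P w') opprB addrACA [- P w + _]addrC -addrACA.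
(* Equal sums make every cosine 1; for distinct sums [h w != h w'] and the cosines average to at
   least [- eta]. *)
have key w w' : w \in W -> w' \in W ->
    ((h w == h w')%:R - eta) * #|I|%:R <= \sum_i ccos (D i w - D i w').
  move=> wW w'W; under [leRHS]eq_bigr => i _ do rewrite DE.
  have [tw|tw] := eqVneq (t w) (t w').
    under [leRHS]eq_bigr => i _ do rewrite tw subrr (tP _ _ tw) subrr addr0 hom0 // ccos0.
    rewrite sumr_const -[leRHS]mul1r ler_pM2r ?ltr0n //.
    have : (h w == h w')%:R <= 1 :> R by rewrite lern1 leq_b1.
    by lra.
  have -> : h w == h w' = false by apply: contra_neqF tw => /eqP; exact: ht.
  rewrite sub0r mulr_natr; apply: avg_ys.
  by rewrite mem_filter subr_eq0 tw; apply/allpairsP; exists (w, w').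
have low : (\sum_(w <- W) \sum_(w' <- W) (h w == h w')%:R - eta * (size W)%:R ^+ 2) * #|I|%:R <=
    \sum_i C (chi i) ^+ N.
  under [leRHS]eq_bigr => i _ do rewrite /C -ccos_words.
  rewrite [leRHS]exchange_big /=.
  have -> : eta * (size W)%:R ^+ 2 = \sum_(w <- W) \sum_(w' <- W) eta.
    by rewrite !big_const_seq !count_predT !iter_addr_0 -mulrnA -[RHS]mulr_natr natrM expr2.
  rewrite -sumrB mulr_suml big_seq [leRHS]big_seq; apply: ler_sum => w wW.
  rewrite [leRHS]exchange_big /= -sumrB mulr_suml big_seq [leRHS]big_seq; apply: ler_sum => w' w'W.
  exact: key.
have up : \sum_i C (chi i) ^+ N <= rho ^+ N * (size W)%:R ^+ 2 * #|I|%:R.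
  have -> : (size W)%:R ^+ 2 = (n ^+ 2) ^+ N :> R by rewrite size_words natrX -!exprM mulnC.
  rewrite -exprMn mulr_natr -sumr_const; apply: ler_sum => i _.
  by apply: lerXn2r; rewrite ?nnegrE ?C_le // (le_trans (C_ge0 (chi i))) // C_le.
have coll := @collision_count R V _ W h.
have W0 : 0 < (size W)%:R ^+ 2 :> R.
  by rewrite size_words natrX -exprM exprn_gt0.
(* From [low], [up] and [coll]; it contradicts the choice of [N], which gives
   [#|V|%:R * rho ^+ N < 1/2]. *)
have eta_le : eta <= rho ^+ N.
  have lu := le_trans low up; rewrite ler_pM2r ?ltr0n // in lu.
  rewrite -(ler_pM2r W0).
  suff : 2 * eta * (size W)%:R ^+ 2 <= \sum_(w <- W) \sum_(w' <- W) (h w == h w')%:R.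
    by move: lu; set Z := \sum_(w <- W) _; lra.
  have -> : 2 * eta = #|V|%:R^-1 by rewrite /eta invfM mulrA mulfV ?mul1r.
  by rewrite ler_pdivrMl.
move: NP; rewrite -cardV ltNge => /negP; apply.
have -> : 1/2 = #|V|%:R * eta by rewrite /eta invfM mulrCA mulfV ?gt_eqF // mulr1 mul1r.
by rewrite ler_pM2l.
Qed.

End Kronecker.

(** * Countable subgroups *)

Section GClosedSubgroups.
Variables (R : realType) (G : topologicalZmodType).

Definition characters_separate := forall x : G, x != 0 ->
  exists2 chi : G -> circle R, pontryagin_dual chi & chi x != 0.

(** By injectivity the complement of [rho x] is a neighbourhood of 1, and the characters attached to
    it cannot all vanish at [x]. *)
Lemma map_characters_separate :
  maximally_almost_periodic (Algebra.to_multiplicative G) -> characters_separate.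
Proof.
move=> [bG [rho [[chbG [rhoD rhoc] _] rho_inj]]] x x0.
have W1 : nbhs (1%g : bG) (~` [set rho x]).
  apply: open_nbhs_nbhs; split.
    by apply: closed_openC; exact: accessible_closed_set1 (hausdorff_accessible chbG.2) _.
  move=> /= rx; move/eqP: x0; apply; apply: rho_inj; rewrite -rx.
  by apply: (@mulgI _ (rho (0 : G))); rewrite mulg1 -rhoD; congr rho; exact/esym/(@addr0 G).
have [L [d [chi [d0 chi_dual chi_d]]]] :=
  @compact_group_characters R G bG rho rhoD rhoc chbG _ W1.
have [j jx] : exists j, chi j x != 0.
  apply: contrapT => nj; have := chi_d x (fun f => f erefl).
  rewrite big1 ?leNgt ?d0 // => j _.
  suff -> : chi j x = 0 by rewrite ccos0 subrr.
  by apply/eqP; apply: contrapT => /negP jx; apply: nj; exists j.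
by exists (chi j).
Qed.

Lemma cvg_circle_near0 (v : nat -> circle R) (m : nat) :
  (forall n, (m <= n)%N -> 1 - ccos (v n) < n.+1%:R^-1) -> v n @[n --> \oo] --> (0 : circle R).
Proof.
move=> vm; apply/cvg_circle0; apply/cvgrPdist_lt => e e0.
near=> n; rewrite ger0_norm ?subr_ge0 ?ccos_le1 //=.
apply: lt_trans (vm n _) _; first by near: n; exact: nbhs_infty_ge.
by near: n; exact: near_infty_natSinv_lt (PosNum e0).
Unshelve. all: by end_near. Qed.

Section Countable.
Variables (H : set G).
Hypotheses (sH : is_subgroup H) (cH : countable H).

Lemma subgroup0 : H 0. Proof. by have [+ _] := sH; rewrite inE. Qed.

Lemma subgroupB x y : H x -> H y -> H (x - y).
Proof. by have [_ /(_ x y)] := sH; rewrite !inE; exact. Qed.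

Lemma subgroupN x : H x -> H (- x).
Proof. by rewrite -sub0r; apply: subgroupB; exact: subgroup0. Qed.

Lemma subgroupD x y : H x -> H y -> H (x + y).
Proof. by move=> Hx Hy; rewrite -[y]opprK; apply: subgroupB => //; exact: subgroupN. Qed.

Lemma subgroupMz x k : H x -> H (x *~ k).
Proof.
move=> Hx; have Hn n : H (x *+ n).
  elim: n => [|n IH]; first by rewrite mulr0n; exact: subgroup0.
  by rewrite mulrS; exact: subgroupD.
by case: k => n; [exact: Hn|rewrite NegzE mulrNz; exact/subgroupN/Hn].
Qed.

Lemma to_circleMn (a : R) n : to_circle (a *+ n) = to_circle a *+ n.
Proof. by elim: n => [|n IH]; rewrite ?to_circle0 // !mulrS to_circleD IH. Qed.

(* Take [theta] of the same order as [x] modulo [H], or of order 2 if that is infinite. *)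
Lemma subgroup_quotient_angle x : ~ H x ->
  exists2 theta : circle R, theta != 0 & forall k, H (x *~ k) -> theta *~ k = 0.
Proof.
move=> nHx; have [[m0 Hm0]|nHm] := pselect (exists m, H (x *+ m.+1)); last first.
  exists (to_circle (1/2)).
    apply/eqP; rewrite -to_circle0 => /to_circle_eq; rewrite subr0 => /norm_intr_ge1.
    by rewrite ger0_norm; [|lra]; move=> /(_ _); rewrite lt0r_neq0; [|lra]; move=> /(_ isT); lra.
  move=> [[|n]|n] Hn; first by rewrite mulr0z.
    by case: nHm; exists n.
  case: nHm; exists n; rewrite -[x *+ _]opprK; apply: subgroupN.
  by rewrite -[- _]/(x *~ (Negz n)).
have /ex_minnP[m Hm min_m] : exists m, `[< H (x *+ m.+1) >] by exists m0; exact/asboolP.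
have {}Hm : H (x *+ m.+1) by exact/asboolP.
(* As [x] is not in [H], its order [m.+1] modulo [H] exceeds 1, so [m.+1%:R^-1] is not an
   integer. *)
have m_gt0 : (0 < m)%N by case: m Hm {min_m} => //; rewrite mulr1n.
exists (to_circle (m.+1%:R^-1)).
  apply/eqP; rewrite -to_circle0 => /to_circle_eq; rewrite subr0 => mi.
  have mV0 : 0 < m.+1%:R^-1 :> R by rewrite invr_gt0 ltr0n.
  have := norm_intr_ge1 mi (lt0r_neq0 mV0); rewrite ger0_norm ?(ltW mV0) //.
  by rewrite leNgt invf_lt1 ?ltr0n // ltr1n ltnS m_gt0.
have tm : to_circle (m.+1%:R^-1) *~ m.+1%:Z = 0 :> circle R.
  rewrite -[LHS]/(_ *+ m.+1) -to_circleMn -[_ *+ m.+1]mulr_natr mulVf ?pnatr_eq0 //.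
  by rewrite -to_circle0; apply/to_circle_eq; rewrite subr0 int_num1.
move=> k Hk; have := divz_eq k m.+1; set q := (k %/ _)%Z; have := @modz_ge0 k m.+1 isT.
have := @ltz_pmod k m.+1 isT; case: (k %% _)%Z => // r rm _ kE.
suff r0 : r = 0%N by rewrite kE r0 addr0 mulrC mulrzA tm mul0rz.
have Hr : H (x *+ r).
  have -> : x *+ r = x *~ k - (x *+ m.+1) *~ q.
    by rewrite kE mulrzDr mulrC mulrzA [_ *~ q + _]addrC addrK.
  by apply: subgroupB => //; exact: subgroupMz.
case: r rm Hr {kE} => // r rm Hr.
have : (m <= r)%N by apply: min_m; exact/asboolP.
by rewrite leqNgt; rewrite ltz_nat ltnS in rm; rewrite rm.
Qed.

Lemma countable_subgroup_enum : exists e : nat -> G, (forall n, H (e n)) /\ H `<=` range e.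
Proof.
have /countable_injP[f finj] := cH.
pose P n : set G := [set h | H h /\ f h = n].
(* Indices that [f] does not reach from [H] take the default 0, an element of [H]. *)
exists (fun n => xget 0 (P n)); split=> [n|h Hh].
  by case: xgetP => [y _ []//|_]; exact: subgroup0.
exists (f h) => //; case: xgetP => [y _ [Hy fy]|/(_ h)[]]; last by split.
by apply: finj; rewrite ?inE.
Qed.

Lemma g_closed_countable : characters_separate -> g_closed R H.
Proof.
move=> sep; apply/seteqP; split=> [x Hx|x Hx u [_ Hu]]; last exact: Hu.
apply: contrapT => nHx; have [theta theta0 thetaP] := subgroup_quotient_angle nHx.
have [e [He eH]] := countable_subgroup_enum.
have /choice[u uP] : forall n : nat, exists chi : G -> circle R,
    [/\ pontryagin_dual chi, 1 - ccos (chi x - theta) < n.+1%:R^-1 &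
      forall m : nat, (m < n)%N -> 1 - ccos (chi (e m)) < n.+1%:R^-1].
  move=> n.
  (* [None] carries the point 0 required as [j0], [Some None] the point [x] with target [theta], and
     the other indices the first [n] terms of [e] with target 0. *)
  pose y (j : option (option 'I_n)) :=
    if j is Some j' then if j' is Some i then e i else x else 0.
  pose p (j : option (option 'I_n)) : circle R := if j is Some None then theta else 0.
  have n0 : 0 < n.+1%:R^-1 :> R by rewrite invr_gt0 ltr0n.
  have [] := @kronecker_density R G (@pontryagin_dual R G) _ _ _ _ _ y p None _ erefl erefl _ n0.
  - by move=> chi [].
  - by split=> [a b|]; [rewrite addr0|exact: cst_continuous].
  - move=> chi psi [chiD chic] [psiD psic]; split=> [a b|].
      by rewrite chiD psiD addrACA.
    exact: (continuous_pair_comp (@add_continuous (circle R))).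
  - exact: sep.
  - move=> k; rewrite (bigD1 (Some None)) //= => yk.
    rewrite (bigD1 (Some None)) //= big1 ?addr0.
      apply: thetaP.
      have -> : x *~ k (Some None) = - \sum_(i | i != Some None) y i *~ k i.
        by apply/eqP; rewrite -addr_eq0 yk.
      apply: subgroupN; elim/big_ind: _ => //; [exact: subgroup0|exact: subgroupD|].
      by move=> [[i|]|] //= _; apply: subgroupMz; [exact: He|exact: subgroup0].
    by move=> [[i|]|] //= _; rewrite mul0rz.
  move=> chi [chiD chic] chi_p; exists chi; split=> [//||m mn]; first exact: (chi_p (Some None)).
  by have := chi_p (Some (Some (Ordinal mn))); rewrite /= subr0.
have ux : u n x @[n --> \oo] --> (0 : circle R).
  apply: (Hx u); split=> [n|h /eH[m _ <-]]; first by have [] := uP n.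
  apply: (@cvg_circle_near0 _ m.+1) => n mn.
  by have [_ _] := uP n; exact.
have uxt : u n x - theta @[n --> \oo] --> (0 : circle R).
  by apply: (@cvg_circle_near0 _ 0) => n _; have [] := uP n.
(* The sequence that tends to 0 also tends to [0 - theta], which forces [theta = 0]. *)
have uxt' : u n x - theta @[n --> \oo] --> 0 - theta.
  apply: (continuous2_cvg _ (h := fun a b : circle R => a - b) _ ux).
    exact: (@sub_continuous (circle R) (_, _)).
  exact: cvg_cst.
have /eqP : (0 : circle R) = 0 - theta.
  by apply: cvg_unique uxt uxt'; exact: hausdorff_circle.
by rewrite sub0r eq_sym oppr_eq0 (negbTE theta0).
Qed.
End Countable.

Lemma cyclic_is_subgroup (x : G) : is_subgroup (cyclic_subgroup x).
Proof.
split=> [|y z]; rewrite !inE.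
  by exists 0 => //; rewrite mulr0z.
by move=> [k _ <-] [l _ <-]; exists (k - l) => //; rewrite mulrzBr.
Qed.

Lemma cyclic_countable (x : G) : countable (cyclic_subgroup x).
Proof. by apply: card_le_trans (card_image_le _ _) _; exact: countableP. Qed.

(** A point killed by every character lies in every [s_set u], hence in the closure of the trivial
    subgroup. *)
Lemma g_closed0_characters_separate :
  g_closed R (cyclic_subgroup (0 : G)) -> characters_separate.
Proof.
move=> g0 x x0; apply: contrapT => nex.
suff : cyclic_subgroup (0 : G) x.
  by move=> [k _]; rewrite mul0rz => /eqP; rewrite eq_sym (negbTE x0).
rewrite -g0 => u [u_dual _] /=.
rewrite /s_set /=.
have -> : (fun n => u n x) = (fun=> 0); last exact: cvg_cst.
apply/funext => n; apply/eqP; apply: contrapT => /negP unx; apply: nex.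
by exists (u n).
Qed.
End GClosedSubgroups.

(** * The Bohr compactification *)

Lemma continuous_prod_topology (T : topologicalType) (I : Type) (K : I -> topologicalType)
    (f : T -> prod_topology K) :
  (forall i, continuous (fun t => f t i)) -> continuous f.
Proof.
move=> cf x; apply/cvg_sup => i; move: x.
apply/(@continuousP _ (initial_topology (fun g : prod_topology K => g i))) => A [B oB <-].
by apply: (@open_comp _ _ (fun t => f t i)) => // y _; exact: cf.
Qed.

Lemma closure_op (X Y Z : topologicalType) (op : X * Y -> Z)
    (A : set X) (B : set Y) (C : set Z) :
  continuous op -> (forall a b, A a -> B b -> C (op (a, b))) ->
  forall a b, closure A a -> closure B b -> closure C (op (a, b)).
Proof.
move=> opc ABC a b Aa Bb W /(opc (a, b))[[U V] [/= aU bV] UVW].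
have [a' [Aa' Ua']] := Aa U aU; have [b' [Bb' Vb']] := Bb V bV.
by exists (op (a', b')); split; [exact: ABC|exact: (UVW (a', b'))].
Qed.

Lemma closure_map (X Y : topologicalType) (f : X -> Y) (A : set X) (B : set Y) :
  continuous f -> (forall a, A a -> B (f a)) -> forall a, closure A a -> closure B (f a).
Proof.
move=> fc AB a Aa W /fc fW; have [a' [Aa' Wa']] := Aa _ fW.
by exists (f a'); split; first exact: AB.
Qed.

Lemma compact_set_type (X : topologicalType) (A : set X) :
  compact A -> compact [set: set_type A].
Proof.
move=> cA F PF _.
have [|p [Ap clp]] := cA (set_val @ F) _.
  suff vA : [set: set_type A] `<=` set_val @^-1` A by exact: filterS vA filterT.
  by move=> [x xA] _; exact: set_mem.
exists (exist _ p (mem_set Ap)); split=> // U V FU.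
move=> [_ /= [[B oB <-]] /= Bp BV].
have [||_ [[z Uz <-] Bz]] := clp (set_val @` U) B.
- suff UU : U `<=` set_val @^-1` (set_val @` U) by exact: filterS UU FU.
  by move=> z Uz; exists z.
- exact: open_nbhs_nbhs.
- by exists z; split=> //; exact: BV.
Qed.

(** Each [y != g x] is excluded near [(x, y)] by the closed graph; compactness of [Y] makes the
    neighbourhood of [x] uniform in [y]. *)
Lemma closed_graph_continuous (X Y : topologicalType) (g : X -> Y) :
  compact [set: Y] -> closed [set p : X * Y | p.2 = g p.1] -> continuous g.
Proof.
move=> /compact_near_coveringP cY clg x V gV.
suff : nbhs x [set x' | [set: Y] `<=` (fun y => y = g x' -> V y)].
  by apply: filterS => x' h; exact: h.
apply: (cY X (nbhs x) (fun x' y => y = g x' -> V y)) => y _.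
have [->|/eqP ygx] := pselect (y = g x).
  exists (V, setT); first by split=> //; exact: filterT.
  by move=> [y' x'] [/= Vy' _] _.
have : nbhs (x, y) (~` [set p : X * Y | p.2 = g p.1]).
  by apply: open_nbhs_nbhs; split; [exact: closed_openC|move=> /= /eqP; exact/negP].
move=> [[P Q] [/= xP yQ] PQ]; exists (Q, P) => //= -[y' x'] [/= Qy' Px'] yg.
by case: (PQ (x', y')).
Qed.

(** * The closure of the group in a power of the circle *)

Section BohrCompactification.
Variables (R : realType) (G : topologicalZmodType).

Definition dual_index : Type := {classic {chi : G -> circle R | pontryagin_dual chi}}.

Definition dual_fun (i : dual_index) : G -> circle R := sval (i : {chi | pontryagin_dual chi}).

Lemma dual_funD i : {morph dual_fun i : x y / x + y}.
Proof. by have [] := svalP (i : {chi | pontryagin_dual chi}). Qed.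

Lemma dual_fun_continuous i : continuous (dual_fun i).
Proof. by have [] := svalP (i : {chi | pontryagin_dual chi}). Qed.

Local Notation X := (prod_topology (fun _ : dual_index => circle R)).

Definition dual_eval (x : G) : X :=
  fun i => dual_fun i x.

Definition bohr : Type := set_type (closure (range dual_eval)).

HB.instance Definition _ := Topological.on bohr.

Let sub_ptws (p : X * X) : X := fun i => p.1 i - p.2 i.

Let proj_ptws i : continuous (fun b : X => b i).
Proof. exact: (@proj_continuous dual_index (fun _ => circle R) i). Qed.

Let sub_ptws_continuous : continuous sub_ptws.
Proof.
apply: continuous_prod_topology => i.
apply: (continuous_pair_comp (op := fun z : circle R * circle R => z.1 - z.2)
  (f := fun p : X * X => p.1 i) (g := fun p : X * X => p.2 i)); first exact: sub_continuous.
  move=> p; apply: (@continuous_comp _ _ _ fst (fun b : X => b i)); first exact: cvg_fst.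
  exact: proj_ptws.
move=> p; apply: (@continuous_comp _ _ _ snd (fun b : X => b i)); first exact: cvg_snd.
exact: proj_ptws.
Qed.

Let dual_fun0 i : dual_fun i 0 = 0.
Proof. by apply: (addrI (dual_fun i 0)); rewrite -dual_funD !addr0. Qed.

Let dual_funB i x y : dual_fun i (x - y) = dual_fun i x - dual_fun i y.
Proof. by apply: (addIr (dual_fun i y)); rewrite -dual_funD !subrK. Qed.

Let range_sub a b : range dual_eval a -> range dual_eval b -> range dual_eval (sub_ptws (a, b)).
Proof.
move=> [x _ <-] [y _ <-]; exists (x - y) => //.
by apply/funext => i; rewrite /dual_eval dual_funB.
Qed.

Definition bohr_coord (b : bohr) (i : dual_index) : circle R := set_val b i.

Lemma bohr_coord_inj b b' : bohr_coord b =1 bohr_coord b' -> b = b'.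
Proof. by move=> bb'; apply: val_inj; apply/funext. Qed.

Let closure_set_val (b : bohr) : closure (range dual_eval) (set_val b).
Proof. exact: set_mem (valP b). Qed.

Let closure_sub (b b' : bohr) :
  closure (range dual_eval) (sub_ptws (set_val b, set_val b')).
Proof. exact: closure_op sub_ptws_continuous range_sub _ _ _ _. Qed.

(** Subtraction is primitive, so that one closure argument yields both opposites and sums. *)
Definition bohr_sub (b b' : bohr) : bohr :=
  exist _ (sub_ptws (set_val b, set_val b')) (mem_set (@closure_sub b b')).

Definition bohr_map (x : G) : bohr :=
  exist _ (dual_eval x) (mem_set (subset_closure (imageP dual_eval I))).

Lemma bohr_subE b b' i : bohr_coord (bohr_sub b b') i = bohr_coord b i - bohr_coord b' i.
Proof. by []. Qed.

Lemma bohr_mapE x i : bohr_coord (bohr_map x) i = dual_fun i x.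
Proof. by []. Qed.

Definition bohr_opp b := bohr_sub (bohr_map 0) b.
Definition bohr_add b b' := bohr_sub b (bohr_opp b').

Let bohr_addE b b' i : bohr_coord (bohr_add b b') i = bohr_coord b i + bohr_coord b' i.
Proof. by rewrite !bohr_subE bohr_mapE dual_fun0 sub0r opprK. Qed.

Lemma bohr_addA : associative bohr_add.
Proof. by move=> a b c; apply: bohr_coord_inj => i; rewrite !bohr_addE addrA. Qed.

Lemma bohr_addC : commutative bohr_add.
Proof. by move=> a b; apply: bohr_coord_inj => i; rewrite !bohr_addE addrC. Qed.

Lemma bohr_add0 : left_id (bohr_map 0) bohr_add.
Proof.
by move=> a; apply: bohr_coord_inj => i; rewrite bohr_addE bohr_mapE dual_fun0 add0r.
Qed.

Lemma bohr_addN : left_inverse (bohr_map 0) bohr_opp bohr_add.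
Proof.
move=> a; apply: bohr_coord_inj => i; rewrite bohr_addE.
by rewrite bohr_subE !bohr_mapE dual_fun0 sub0r addNr.
Qed.

HB.instance Definition _ := GRing.isZmodule.Build bohr bohr_addA bohr_addC bohr_add0 bohr_addN.

Lemma bohr_coord_continuous i : continuous (bohr_coord^~ i).
Proof.
move=> b; apply: (@continuous_comp _ _ _ (set_val : bohr -> X) (fun b : X => b i)).
  exact: initial_continuous.
exact: proj_ptws.
Qed.

Lemma bohr_coordD b b' i : bohr_coord (b + b') i = bohr_coord b i + bohr_coord b' i.
Proof. exact: bohr_addE. Qed.

Lemma bohr_coordN b i : bohr_coord (- b) i = - bohr_coord b i.
Proof. by rewrite -[- b]/(bohr_opp b) bohr_subE bohr_mapE dual_fun0 sub0r. Qed.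

Lemma continuous_to_bohr (T : topologicalType) (f : T -> bohr) :
  (forall i, continuous (fun t => bohr_coord (f t) i)) -> continuous f.
Proof.
move=> cf; apply: continuous_comp_initial; exact: continuous_prod_topology.
Qed.

Lemma bohr_sub_continuous : continuous (fun p : bohr * bohr => p.1 - p.2).
Proof.
apply: continuous_to_bohr => i.
have -> : (fun p : bohr * bohr => bohr_coord (p.1 - p.2) i) =
    (fun p => bohr_coord p.1 i - bohr_coord p.2 i).
  by apply/funext => p; rewrite bohr_coordD bohr_coordN.
apply: (continuous_pair_comp (op := fun z : circle R * circle R => z.1 - z.2)
  (f := fun p : bohr * bohr => bohr_coord p.1 i)
  (g := fun p : bohr * bohr => bohr_coord p.2 i)); first exact: sub_continuous.
  move=> p; apply: (@continuous_comp _ _ _ fst (bohr_coord^~ i)); first exact: cvg_fst.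
  exact: bohr_coord_continuous.
move=> p; apply: (@continuous_comp _ _ _ snd (bohr_coord^~ i)); first exact: cvg_snd.
exact: bohr_coord_continuous.
Qed.

HB.instance Definition _ :=
  PreTopologicalNmodule_isTopologicalZmodule.Build bohr bohr_sub_continuous.

Lemma bohr_mapD : {morph bohr_map : x y / x + y}.
Proof.
by move=> x y; apply: bohr_coord_inj => i; rewrite bohr_coordD !bohr_mapE dual_funD.
Qed.

Lemma bohr_map_continuous : continuous bohr_map.
Proof. by apply: continuous_to_bohr => i; exact: dual_fun_continuous. Qed.

Lemma bohr_map_dense b : closure (range bohr_map) b.
Proof.
move=> V [_ /= [[B oB <-]] /= Bb BV].
have [_ [[x _ <-] Bx]] := closure_set_val (open_nbhs_nbhs (conj oB Bb)).
by exists (bohr_map x); split; [exists x|exact: BV].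
Qed.

Lemma bohr_compact : compact [set: bohr].
Proof.
apply: compact_set_type; apply: (subclosed_compact (B := setT)) => //.
  exact: closed_closure.
have := @tychonoff dual_index (fun _ => circle R) (fun _ => setT) (fun _ => @compact_circle R).
by congr compact; apply/seteqP; split.
Qed.

Lemma bohr_hausdorff : hausdorff_space bohr.
Proof.
move=> b b' bb'; apply: bohr_coord_inj => i.
exact: cluster_continuous_eq (@hausdorff_circle R) (@bohr_coord_continuous i) bb'.
Qed.

Lemma bohr_map_inj : characters_separate R G -> injective bohr_map.
Proof.
move=> sep x y xy; apply/eqP; rewrite -subr_eq0; apply: contraT => /sep[chi dchi].
have := congr1 (bohr_coord^~ (exist _ chi dchi : dual_index)) xy.
rewrite !bohr_mapE => /eqP; rewrite -subr_eq0 -dual_funB /dual_fun /=.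
by move=> ->.
Qed.

End BohrCompactification.

(** * The universal property *)

Section BohrUniversal.
Variables (R : realType) (G : topologicalZmodType) (K : topologicalGroupType).
Variable phi : G -> K.
Hypothesis phiD : forall x y, phi (x + y) = (phi x * phi y)%g.
Hypothesis phic : continuous phi.
Hypothesis chK : compact_hausdorff K.
Local Notation bohr := (bohr R G).
Local Notation bohr_map := (@bohr_map R G).

Definition bohr_graph : set (bohr * K) := closure (range (fun x => (bohr_map x, phi x))).

Let phi0 : phi 0 = 1%g.
Proof. by apply: (@mulgI _ (phi 0)); rewrite -phiD addr0 mulg1. Qed.

Let phiN x : phi (- x) = (phi x)^-1%g.
Proof. by apply: (@mulgI _ (phi x)); rewrite -phiD subrr mulgV phi0. Qed.

(** By density, the sets of values of [phi] at points mapped near [b] generate a proper filter; its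
    cluster points in the compact [K] lie over [b]. *)
Lemma bohr_graph_total b : exists k, bohr_graph (b, k).
Proof.
pose F := phi @ filter_from (nbhs b) (fun U => bohr_map @^-1` U).
have FF : ProperFilter F.
  apply: fmap_proper_filter; apply: filter_from_proper.
    apply: filter_from_filter; first by exists setT; exact: filterT.
    by move=> U V bU bV; exists (U `&` V) => //; exact: filterI.
  by move=> U /bohr_map_dense[_ [[x _ <-] Ux]]; exists x.
have [k [_ Fk]] := chK.1 F FF filterT.
exists k => W [[U V] [/= bU kV] UVW].
have [|_ [[x Ux <-] Vx]] := Fk (phi @` (bohr_map @^-1` U)) V _ kV.
  by exists U => // x Ux; exists x.
by exists (bohr_map x, phi x); split; [exists x|exact: UVW].
Qed.

(* Two points of the graph over [b] are limits of [phi x] and [phi y] with [x - y]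
   small for finitely many characters of [G]; these control [phi (x - y)]. *)
Lemma bohr_graph_functional b k k' : bohr_graph (b, k) -> bohr_graph (b, k') -> k = k'.
Proof.
move=> bk bk'; apply: contrapT => kk'.
have k1 : (1%g : K) != (k^-1 * k')%g.
  by apply/eqP => k1; apply: kk'; rewrite -[k]mulg1 k1 mulVKg.
have := chK.2; rewrite open_hausdorff => /(_ _ _ k1)[[W W'] /=].
rewrite !inE => -[W1 W'k] [oW oW' WW'].
have [L [d [chi [d0 chi_dual chi_d]]]] :=
  @compact_group_characters R G K phi phiD phic chK W (open_nbhs_nbhs (conj oW W1)).
pose i (j : 'I_L) : dual_index R G := exist _ (chi j) (chi_dual j).
(* [S] measures closeness in [bohr] by the controlling characters; it is continuous and vanishes on
   the diagonal. *)
pose S (p : bohr * bohr) : R := \sum_j (1 - ccos (bohr_coord p.2 (i j) - bohr_coord p.1 (i j))).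
have Sc : continuous S.
  move=> p; apply: cvg_sumr => j; apply: cvgB; first exact: cvg_cst.
  have subc : continuous (fun p : bohr * bohr => bohr_coord p.2 (i j) - bohr_coord p.1 (i j)).
    apply: (continuous_pair_comp (op := fun z : circle R * circle R => z.1 - z.2)
      (f := fun p : bohr * bohr => bohr_coord p.2 (i j))
      (g := fun p : bohr * bohr => bohr_coord p.1 (i j))); first exact: sub_continuous.
      move=> q; apply: (@continuous_comp _ _ _ snd (@bohr_coord R G ^~ (i j))).
        exact: cvg_snd.
      exact: bohr_coord_continuous.
    move=> q; apply: (@continuous_comp _ _ _ fst (@bohr_coord R G ^~ (i j))); first exact: cvg_fst.
    exact: bohr_coord_continuous.
  by apply: continuous_cvg; [exact: continuous_ccos|exact: subc].
have [U bU US] : exists2 U, nbhs b U & forall b1 b2, U b1 -> U b2 -> S (b1, b2) < d.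
  have := Sc (b, b) _ (nbhsx_ballx (S (b, b) : R^o) _ d0).
  have -> : S (b, b) = 0 by rewrite /S big1 // => j _ /=; rewrite subrr ccos0 subrr.
  move=> [[U V] [/= bU bV] UVS]; exists (U `&` V); first exact: filterI.
  move=> b1 b2 [Ub1 _] [_ Vb2]; have := UVS (b1, b2) (conj Ub1 Vb2).
  by rewrite /ball /= sub0r normrN; apply: le_lt_trans; exact: ler_norm.
have [P [Q [kP k'Q PQ]]] : exists P Q, [/\ nbhs k P, nbhs k' Q &
    forall p q, P p -> Q q -> W' (p^-1 * q)%g].
  have divc : continuous (fun p : K * K => (p.1^-1 * p.2)%g).
    apply: continuous_mulg2; last by move=> p; exact: cvg_snd.
    by apply: continuous_invg => p; exact: cvg_fst.
  have [[P Q] [/= kP k'Q] PQ] := divc (k, k') W' (open_nbhs_nbhs (conj oW' W'k)).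
  by exists P, Q; split=> // p q Pp Qq; exact: (PQ (p, q)).
have [_ [[x _ <-] [/= Ux Px]]] : range (fun x => (bohr_map x, phi x)) `&` (U `*` P) !=set0.
  by apply: bk; exists (U, P).
have [_ [[y _ <-] [/= Uy Qy]]] : range (fun x => (bohr_map x, phi x)) `&` (U `*` Q) !=set0.
  by apply: bk'; exists (U, Q).
have W'yx : W' (phi (y - x)) by rewrite addrC phiD phiN; exact: PQ.
have nWyx : ~ W (phi (y - x)).
  by move=> Wyx; have : (W `&` W') (phi (y - x)) by []; rewrite WW'.
have := US _ _ Ux Uy; rewrite ltNge => /negP; apply.
apply: le_trans (chi_d _ nWyx) _; apply: ler_sum => j _.
have [chiD _] := chi_dual j.
have -> : chi j (y - x) = chi j y - chi j x by apply: (addIr (chi j x)); rewrite -chiD !subrK.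
by [].
Qed.

Lemma bohr_graphM b k b' k' : bohr_graph (b, k) -> bohr_graph (b', k') ->
  bohr_graph (b + b', (k * k')%g).
Proof.
pose op (q : (bohr * K) * (bohr * K)) := (q.1.1 + q.2.1, (q.1.2 * q.2.2)%g).
have opc : continuous op.
  have fstc (X Y : topologicalType) : continuous (@fst X Y) by move=> ?; exact: cvg_fst.
  have sndc (X Y : topologicalType) : continuous (@snd X Y) by move=> ?; exact: cvg_snd.
  have addc : continuous (fun q : (bohr * K) * (bohr * K) => q.1.1 + q.2.1).
    apply: (continuous_pair_comp (op := fun z : bohr * bohr => z.1 + z.2)
      (f := fun q : (bohr * K) * (bohr * K) => q.1.1)
      (g := fun q : (bohr * K) * (bohr * K) => q.2.1)); first exact: add_continuous.
      by move=> q; apply: (@continuous_comp _ _ _ fst fst); [exact: fstc|exact: fstc].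
    by move=> q; apply: (@continuous_comp _ _ _ snd fst); [exact: sndc|exact: fstc].
  have mulc : continuous (fun q : (bohr * K) * (bohr * K) => (q.1.2 * q.2.2)%g).
    apply: continuous_mulg2.
      by move=> q; apply: (@continuous_comp _ _ _ fst snd); [exact: fstc|exact: sndc].
    by move=> q; apply: (@continuous_comp _ _ _ snd snd); [exact: sndc|exact: sndc].
  exact: (continuous_pair_comp (op := id) (fun p => cvg_id) addc mulc).
apply: (closure_op (op := op)) => // _ _ [x _ <-] [y _ <-].
by exists (x + y) => //; rewrite /op /= bohr_mapD phiD.
Qed.

(** The closure of the graph of [phi] is the graph of [g]: [bohr_graphM] makes [g] a homomorphism,
    and its closed graph in a product with the compact [K] makes it continuous. *)
Lemma bohr_extension : exists! g : bohr -> K,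
  [/\ {morph g : x y / x + y >-> (x * y)%g}, continuous g & phi = g \o bohr_map].
Proof.
have [g gP] := choice bohr_graph_total.
exists g; split; first split.
- by move=> b b'; apply: bohr_graph_functional (gP _) _; exact: bohr_graphM.
- apply: closed_graph_continuous chK.1 _.
  have -> : [set p : bohr * K | p.2 = g p.1] = bohr_graph.
    apply/seteqP; split=> -[b k] /=; first by move=> ->.
    by move=> bk; apply: bohr_graph_functional bk (gP b).
  exact: closed_closure.
- apply/funext => x; apply: bohr_graph_functional (gP _); apply: subset_closure.
  by exists x.
(* Over the dense image of [G], the graph of [g'] lies in that of [phi]; by continuity all of it
   lies in the closure. *)
move=> g' [_ g'c phiE]; apply/funext => b; apply: bohr_graph_functional (gP b) _.
have pairc : continuous (fun b : bohr => (b, g' b)).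
  by apply: (continuous_pair_comp (op := id) (f := id)) => // p; exact: cvg_id.
have pair_range c : range bohr_map c -> range (fun x => (bohr_map x, phi x)) (c, g' c).
  by move=> [x _ <-]; exists x => //; rewrite phiE.
by apply: (closure_map pairc pair_range); exact: bohr_map_dense.
Qed.
End BohrUniversal.

Lemma separate_maximally_almost_periodic (R : realType) (G : topologicalZmodType) :
  characters_separate R G -> maximally_almost_periodic (Algebra.to_multiplicative G).
Proof.
move=> sep.
exists (Algebra.to_multiplicative (bohr R G) : topologicalGroupType), (@bohr_map R G).
split; last exact: bohr_map_inj.
split.
- by split; [exact: bohr_compact|exact: bohr_hausdorff].
- by split; [exact: bohr_mapD|exact: bohr_map_continuous].
move=> K f chK [fD fc].
have [g [[gD gc fg] gU]] := @bohr_extension R G K f fD fc chK.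
exists g; split; first by [].
by move=> g' [[g'D g'c] fg']; apply: gU.
Qed.

Theorem theorem1p4 (R : realType) (G : topologicalZmodType) :
  [<-> maximally_almost_periodic (Algebra.to_multiplicative G);
       forall H : set G, is_subgroup H -> countable H -> g_closed R H;
       forall x : G, g_closed R (cyclic_subgroup x)].
Proof.
tfae.
- by move=> /(@map_characters_separate R) sep H sH cH; exact: g_closed_countable.
- by move=> gc x; apply: gc; [exact: cyclic_is_subgroup|exact: cyclic_countable].
- move=> gc; apply: (@separate_maximally_almost_periodic R).
  exact: g_closed0_characters_separate.
Qed.
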